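(* Let $G=\mathrm{Sz}(2^p)$ be a minimal simple group, where $q=2^p$ and $p$ is an odd prime. Then $\alpha(G)\ge q^2+1$.
   Context: $\mathrm{Sz}(q)$ denotes the Suzuki group over the field with $q$ elements, of order $q^2(q^2+1)(q-1)$. For a finite group $G$, $R(G)$ denotes the solvable radical of $G$ (the largest solvable normal subgroup). For $x\in G$, the solvabilizer of $x$ is $\mathrm{Sol}_G(x)=\{y\in G\mid \langle x,y\rangle \text{ is solvable}\}$. For nonsolvable $G$, a solvabilizer covering of $G$ is a set $X\subset G\setminus R(G)$ such that $G=\bigcup_{x\in X}\mathrm{Sol}_G(x)$, and the solvabilizer number $\alpha(G)$ is the minimum cardinality of a solvabilizer covering of $G$. A minimal simple group is a nonabelian simple group all of whose proper subgroups are solvable. *)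

(* Defs.v *)
From HB Require Import structures.
From mathcomp Require Import all_boot all_order all_algebra all_fingroup.
From mathcomp Require Import all_solvable.

Set Implicit Arguments.
Unset Strict Implicit.
Unset Printing Implicit Defensive.

Import GroupScope.

Section Solvabilizers.

Variable gT : finGroupType.
Implicit Types (G H K : {group gT}) (X : {set gT}) (x : gT).

Definition minimal_simple G : Prop :=
  [/\ simple G, ~~ abelian G & forall H, H \proper G -> solvable H].

(* The subgroup generated by all solvable normal subgroups of G; that it is
   the largest one is proved in sol_radical_normal, sol_radical_sol and
   sol_radical_max below. *)
Definition sol_radical G : {set gT} :=
  <<\bigcup_(H : {group gT} | (H <| G) && solvable H) H>>.

Canonical sol_radical_group G := [group of sol_radical G].

Definition solvabilizer G x : {set gT} := [set y in G | solvable <<[set x; y]>>].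

Definition sol_covering G X : bool :=
  (X \subset G :\: sol_radical G) && (G :==: \bigcup_(x in X) solvabilizer G x).

(* When G is not solvable, G :\: sol_radical G is itself a solvabilizer
   covering (sol_covering_default), so the minimum is a genuine one. The value
   for solvable G is meaningless. *)
Definition solvabilizer_number G : nat :=
  #|[arg min_(X < G :\: sol_radical G | sol_covering G X) #|X| ]|.

Lemma joing_normal_sol G H K : H <| G -> solvable H -> K <| G -> solvable K ->
  (H <*> K <| G) && solvable (H <*> K).
Proof.
move=> nHG solH nKG solK; rewrite normalY //=.
have nKH : H \subset 'N(K).
  by rewrite (subset_trans (normal_sub nHG)) ?normal_norm.
rewrite (@series_sol _ _ K) ?solK /=; last first.
  by rewrite /normal joing_subr join_subG nKH normG.
by rewrite quotientYidr // quotient_sol.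
Qed.

Lemma sol_radical_normal_sol G :
  (sol_radical G <| G) && solvable (sol_radical G).
Proof.
rewrite /sol_radical -bigprodGE.
elim/big_rec: _ => [|H K /andP[nHG solH] /andP[nKG solK]].
  by rewrite normal1 solvable1.
exact: joing_normal_sol.
Qed.

Lemma sol_radical_normal G : sol_radical G <| G.
Proof. by case/andP: (sol_radical_normal_sol G). Qed.

Lemma sol_radical_sol G : solvable (sol_radical G).
Proof. by case/andP: (sol_radical_normal_sol G). Qed.

Lemma sol_radical_max G H : H <| G -> solvable H -> H \subset sol_radical G.
Proof.
by move=> nHG solH; rewrite sub_gen // (bigcup_sup H) // nHG.
Qed.

Lemma sol_covering_default G :
  ~~ solvable G -> sol_covering G (G :\: sol_radical G).
Proof.
move=> nsolG; rewrite /sol_covering subxx eqEsubset /=.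
apply/andP; split; last first.
  by apply/bigcupsP=> x _; apply/subsetP=> y; rewrite inE => /andP[].
have solC x : solvable <[x]> by rewrite abelian_sol ?cycle_abelian.
apply/subsetP=> y Gy; case: (boolP (y \in sol_radical G)) => Ry; last first.
  apply/bigcupP; exists y; first by rewrite inE Ry.
  by rewrite inE Gy setUid solC.
have /subsetPn[x Gx nRx] : ~~ (G \subset sol_radical G).
  by apply: contra nsolG => sGR; apply: solvableS sGR (sol_radical_sol G).
apply/bigcupP; exists x; first by rewrite inE nRx.
have nRX : <[x]> \subset 'N(sol_radical G).
  by rewrite cycle_subG (subsetP (normal_norm (sol_radical_normal G))).
have solRx : solvable (sol_radical G <*> <[x]>).
  have nRRx : sol_radical G <| sol_radical G <*> <[x]>.
    by rewrite /normal joing_subl join_subG normG nRX.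
  rewrite (series_sol nRRx) sol_radical_sol /= quotientYidl // quotient_sol //.
  exact: solC.
rewrite inE Gy; apply: solvableS solRx; rewrite gen_subG.
apply/subsetP=> z /set2P[]-> ; apply/mem_gen; rewrite inE ?Ry //.
by rewrite cycle_id orbT.
Qed.

End Solvabilizers.

Section Suzuki.

Import GRing.Theory.
Local Open Scope ring_scope.

Variable F : finFieldType.

(* For #|F| = 2 ^ (2 * n + 1) this is n. *)
Definition suz_n : nat := (logn 2 #|F|)./2.

(* For #|F| = 2 ^ (2 * n + 1), the automorphism of F whose square is the
   Frobenius automorphism. *)
Definition suz_theta (x : F) : F := x ^+ (2 ^ suz_n.+1).

Definition mx4 (rows : seq (seq F)) : 'M[F]_4 :=
  \matrix_(i, j) nth 0 (nth [::] rows i) j.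

Definition suz_S (a b : F) : 'M[F]_4 :=
  let t := suz_theta in
  mx4 [:: [:: 1; 0; 0; 0];
          [:: a; 1; 0; 0];
          [:: b; t a; 1; 0];
          [:: a ^+ 2 * t a + a * b + t b; a * t a + b; a; 1]].

Definition suz_M (l : F) : 'M[F]_4 :=
  let k := (2 ^ suz_n)%N in
  mx4 [:: [:: l ^+ k.+1; 0; 0; 0];
          [:: 0; l ^+ k; 0; 0];
          [:: 0; 0; l ^- k; 0];
          [:: 0; 0; 0; l ^- k.+1]].

Definition suz_T : 'M[F]_4 :=
  mx4 [:: [:: 0; 0; 0; 1];
          [:: 0; 0; 1; 0];
          [:: 0; 1; 0; 0];
          [:: 1; 0; 0; 0]].

Lemma suz_S_unit a b : suz_S a b \in unitmx.
Proof.
rewrite unitmxE det_trig; last first.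
  apply/is_trig_mxP => -[[|[|[|[|i]]]] hi] [[|[|[|[|j]]]] hj] //=;
    by rewrite mxE.
by rewrite !big_ord_recl big_ord0 !mxE /= !mulr1 unitr1.
Qed.

Lemma suz_M_unit l : l != 0 -> suz_M l \in unitmx.
Proof.
move=> l0; rewrite unitmxE det_trig; last first.
  apply/is_trig_mxP => -[[|[|[|[|i]]]] hi] [[|[|[|[|j]]]] hj] //=;
    by rewrite mxE.
by rewrite !big_ord_recl big_ord0 !mxE /= !unitrM !unitrV !unitrX ?unitfE ?oner_eq0.
Qed.

Lemma suz_T_unit : suz_T \in unitmx.
Proof.
apply: (proj1 (mulmx1_unit (B := suz_T) _)).
apply/matrixP => -[[|[|[|[|i]]]] hi] [[|[|[|[|j]]]] hj] //=;
  by rewrite !mxE !big_ord_recl big_ord0 !mxE /= ?mulr0 ?mul0r ?mulr1 ?addr0 ?add0r.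
Qed.

(* Suzuki's 4-dimensional matrix group Sz(q), with generators as in Huppert and
   Blackburn, Finite Groups III, Chapter XI, Section 3; meaningful when
   q = #|F| is an odd power of 2. The matrices are invertible (suz_S_unit,
   suz_M_unit, suz_T_unit), so no generator is lost by working in the unit
   group. *)
Definition Sz : {set {'GL_4[F]}} :=
  << [set u : {'GL_4[F]} | [|| [exists a, exists b, GLval u == suz_S a b],
                               [exists l, (l != 0) && (GLval u == suz_M l)] |
                               GLval u == suz_T]] >>%g.

Canonical Sz_group := [group of Sz].

End Suzuki.

(* Main.v *)
Require Import Defs.
From mathcomp Require Import all_boot all_order all_algebra all_fingroup.
From mathcomp Require Import all_solvable.
From mathcomp Require Import all_field all_character ring zify.

(* Write q = 2 ^ p. Call y in Sz(q) a torus element if its order is a prime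
   divisor l of q^2 + 1. The order of q modulo l is 4, so y acts irreducibly on
   F^4 and its centraliser C(y) lies in the field F[y]; hence C(y) is an abelian
   Hall subgroup of order dividing q^2 + 1, it is the centraliser of each of its
   nontrivial elements, and it contains at most 4 conjugates of y, the roots of
   the characteristic polynomial of y. Looking at a minimal normal subgroup of
   a solvable group <x, y> shows that x normalises C(y). Involutions of N(C(y))
   invert C(y), so there are at most |C(y)| of them.

   Some C(y) has order at most q - 1: otherwise the Hall property would leave a
   single torus, of order q^2 + 1, and counting its conjugates modulo q^2 + 1
   gives a contradiction. For such a y, every x != 1 generates a solvable
   subgroup with at most q^2 elements of the class of y: one may take x of prime
   order, and then x is either an involution, where |C(x)| <= q^2 allows a
   double count, or an element of C(z) for all those z. As the class of y has
   at least q^2 (q^2 + 1) elements, a covering has at least q^2 + 1 members. *)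

(** * Matrix identities for the generators of the Suzuki group *)

Module SuzukiMatrix.

Set Implicit Arguments.
Unset Strict Implicit.
Unset Printing Implicit Defensive.

Import GRing.Theory.
Local Open Scope ring_scope.

Section Matrices.

Variable F : finFieldType.

(** Products of explicit matrices stay in list form, so a matrix identity splits into sixteen
    identities in [F]. *)
Lemma mul_mx4 (a0 a1 a2 a3 b0 b1 b2 b3 c0 c1 c2 c3 d0 d1 d2 d3 : F)
    (e0 e1 e2 e3 f0 f1 f2 f3 g0 g1 g2 g3 h0 h1 h2 h3 : F) :
  mx4 [:: [:: a0; a1; a2; a3]; [:: b0; b1; b2; b3];
          [:: c0; c1; c2; c3]; [:: d0; d1; d2; d3]] *m
  mx4 [:: [:: e0; e1; e2; e3]; [:: f0; f1; f2; f3];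
          [:: g0; g1; g2; g3]; [:: h0; h1; h2; h3]] =
  let r x y z t := [:: x * e0 + y * f0 + z * g0 + t * h0;
                       x * e1 + y * f1 + z * g1 + t * h1;
                       x * e2 + y * f2 + z * g2 + t * h2;
                       x * e3 + y * f3 + z * g3 + t * h3] in
  mx4 [:: r a0 a1 a2 a3; r b0 b1 b2 b3; r c0 c1 c2 c3; r d0 d1 d2 d3].
Proof.
apply/matrixP => -[[|[|[|[|i]]]] hi] [[|[|[|[|j]]]] hj] //=;
  by rewrite !mxE !big_ord_recl big_ord0 !mxE /= addr0 !addrA.
Qed.

End Matrices.

(* As a rewrite rule of [ring], 2 = 0 only applies to the coefficient 2. *)
Lemma char2_even (F : fieldType) :
  2%:R = 0 :> F -> forall n, (2 * n)%:R = 0 :> F.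
Proof. by move=> c2 n; rewrite natrM c2 mul0r. Qed.

(** With both sides on the left, equal monomials collect into even coefficients, which the rewrite
    rules of [ring2] and [field2] send to 0. *)
Lemma addr2_eq (F : fieldType) (x y : F) : 2%:R = 0 :> F -> x + y = 0 -> x = y.
Proof.
move=> c2 xy; rewrite -[x]addr0 -(mul0r y) -c2 mulr_natl mulr2n.
by rewrite addrA xy add0r.
Qed.

Ltac ring2 c2 := apply: (addr2_eq c2); ring: c2
  (char2_even c2 2) (char2_even c2 3) (char2_even c2 4) (char2_even c2 5).
Ltac field2 c2 := apply: (addr2_eq c2); field: c2
  (char2_even c2 2) (char2_even c2 3) (char2_even c2 4) (char2_even c2 5)
  (char2_even c2 6) (char2_even c2 7) (char2_even c2 8) (char2_even c2 9)
  (char2_even c2 10) (char2_even c2 11) (char2_even c2 12).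

Section SuzukiMatrices.

Variables (p : nat) (F : finFieldType).
Hypotheses (p_odd : odd p) (cardF : #|F| = (2 ^ p)%N).

Local Notation q := (2 ^ p)%N.
Local Notation k := (2 ^ suz_n F)%N.
Local Notation theta := (@suz_theta F).

Lemma suz_pE : p = (suz_n F).*2.+1.
Proof. by rewrite /suz_n cardF pfactorK // -[LHS]odd_double_half p_odd. Qed.

Lemma suz_pchar2 : 2 \in [pchar F].
Proof. exact: card_finPcharP cardF _. Qed.

Lemma suz_two : 2%:R = 0 :> F.
Proof. by apply/eqP; case/andP: suz_pchar2. Qed.

Lemma thetaD : {morph theta : x y / x + y}.
Proof.
by move=> x y; rewrite /suz_theta exprDn_pchar ?(pnatX, pnatE) ?suz_pchar2.
Qed.

Lemma thetaM : {morph theta : x y / x * y}.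
Proof. by move=> x y; rewrite /suz_theta exprMn. Qed.

Lemma theta0 : theta 0 = 0.
Proof. by rewrite /suz_theta expr0n expn_eq0. Qed.

Lemma theta1 : theta 1 = 1.
Proof. by rewrite /suz_theta expr1n. Qed.

Lemma thetaV : {morph theta : x / x^-1}.
Proof. by move=> x; rewrite /suz_theta exprVn. Qed.

Lemma theta_eq0 x : (theta x == 0) = (x == 0).
Proof. by rewrite /suz_theta expf_eq0 expn_gt0. Qed.

(** The two exponents multiply to 2q, and [x ^+ q = x]. *)
Lemma thetaK x : theta (theta x) = x ^+ 2.
Proof.
rewrite /suz_theta -exprM -expnD.
have -> : ((suz_n F).+1 + (suz_n F).+1 = p + 1)%N by rewrite suz_pE; lia.
by rewrite expnD exprM -cardF expf_card.
Qed.

Lemma theta_expk x : theta (x ^+ k) = x.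
Proof.
rewrite /suz_theta -exprM -expnD addnS addnn -suz_pE -cardF.
exact: expf_card.
Qed.

Lemma thetaXk x : theta x ^+ k = x.
Proof. by rewrite -[RHS]theta_expk /suz_theta -!exprM mulnC. Qed.

(* Suzuki's parametrisation of the diagonal subgroup has l = theta z. *)
Definition suz_D (z : F) : 'M[F]_4 :=
  mx4 [:: [:: z * theta z; 0; 0; 0]; [:: 0; z; 0; 0];
          [:: 0; 0; z^-1; 0]; [:: 0; 0; 0; (z * theta z)^-1]].

Lemma suz_M_theta z : suz_M (theta z) = suz_D z.
Proof. by rewrite /suz_M /suz_D !exprSr !thetaXk. Qed.

Lemma mul_suz_S a b c d :
  suz_S a b *m suz_S c d = suz_S (a + c) (b + d + theta a * c) :> 'M[F]_4.
Proof.
rewrite /suz_S mul_mx4 /= !thetaD !thetaM !thetaK.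
have c2 := suz_two.
congr (mx4 [:: [:: _; _; _; _]; [:: _; _; _; _]; [:: _; _; _; _];
              [:: _; _; _; _]]); ring2 c2.
Qed.

Lemma suz_S0 : suz_S 0 0 = 1%:M :> 'M[F]_4.
Proof.
apply/matrixP => -[[|[|[|[|i]]]] hi] [[|[|[|[|j]]]] hj] //=;
  by rewrite !mxE /= ?(theta0, mul0r, mulr0, addr0) // expr0n /= ?(mul0r, addr0).
Qed.

Lemma mul_suz_D z w : suz_D z *m suz_D w = suz_D (z * w).
Proof.
rewrite /suz_D mul_mx4 /= !thetaM !invfM.
congr (mx4 [:: [:: _; _; _; _]; [:: _; _; _; _]; [:: _; _; _; _];
              [:: _; _; _; _]]); ring.
Qed.

Lemma mul_suz_D_S z a b : z != 0 ->
  suz_D z *m suz_S a b =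
    suz_S (a / theta z) (b / (z ^+ 2 * theta z)) *m suz_D z.
Proof.
move=> z0; have tz0 : theta z != 0 by rewrite theta_eq0.
rewrite /suz_D /suz_S !mul_mx4 /= !(thetaM, thetaV, thetaK).
congr (mx4 [:: [:: _; _; _; _]; [:: _; _; _; _]; [:: _; _; _; _];
              [:: _; _; _; _]]).
all: rewrite ?expr2 ?thetaM; field; rewrite ?z0 ?tz0 //.
Qed.

Lemma mul_suz_T_D z : suz_T F *m suz_D z = suz_D z^-1 *m suz_T F.
Proof.
rewrite /suz_D /suz_T !mul_mx4 /= !thetaV !invfM !invrK.
congr (mx4 [:: [:: _; _; _; _]; [:: _; _; _; _]; [:: _; _; _; _];
              [:: _; _; _; _]]); ring.
Qed.

Lemma mul_suz_T : suz_T F *m suz_T F = 1%:M.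
Proof.
rewrite /suz_T !mul_mx4 /=.
apply/matrixP => -[[|[|[|[|i]]]] hi] [[|[|[|[|j]]]] hj] //=;
  by rewrite !mxE /= ?(mul0r, mulr0, addr0, add0r, mul1r).
Qed.

Definition suz_N (a b : F) : F := a ^+ 2 * theta a + a * b + theta b.

(* If a != 0, then t = b / (a * theta a) would satisfy theta t = t + 1. *)
Lemma suz_N_eq0 a b : (suz_N a b == 0) = (a == 0) && (b == 0).
Proof.
have [-> | a0] := eqVneq a 0.
  by rewrite /suz_N theta0 mulr0 mul0r !add0r theta_eq0.
apply/negbTE/negP => /eqP N0.
have ta0 : theta a != 0 by rewrite theta_eq0.
have c2 := suz_two.
pose t := b / (a * theta a).
have tE : theta t = t + 1.
  rewrite /t thetaM thetaV thetaM thetaK.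
  apply: (@mulfI _ (a ^+ 2 * theta a)); first by rewrite mulf_neq0 ?expf_neq0.
  have -> : theta b = a ^+ 2 * theta a + a * b.
    by rewrite -[RHS]addr0 -[X in _ + X]N0 /suz_N; ring2 c2.
  by field2 c2; rewrite a0 ta0.
(* A second application of [theta] gives t ^ 2 = t + 2 = t, so t is 0 or 1. Both are fixed by
   [theta], against [tE]. *)
have tt := congr1 theta tE.
rewrite thetaK thetaD theta1 tE in tt.
have : t * (t + 1) = 0 by rewrite mulrDr mulr1 -expr2 tt; ring2 c2.
move/eqP; rewrite mulf_eq0 => /orP[/eqP t0 | /eqP t1].
  by move: tE; rewrite t0 theta0 add0r => /esym/eqP; rewrite oner_eq0.
have {t1} t1 : t = 1 by rewrite -[LHS]addr0 -[X in _ + X]t1; ring2 c2.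
by move: tE; rewrite t1 theta1 -mulr2n c2 => /eqP; rewrite oner_eq0.
Qed.

(** The rank one relation behind the Bruhat decomposition. [suz_N a b] is the lower left entry of
    [suz_S a b], hence the upper right entry of the conjugate by [suz_T]; it is invertible here. *)
Lemma suz_T_S_T a b : (a != 0) || (b != 0) ->
  let N := suz_N a b in
  let c := (a * theta a + b) / N in
  suz_T F *m suz_S a b *m suz_T F =
    suz_S (b / N) (a / N) *m suz_D (theta N / N) *m suz_T F
      *m suz_S c (a / N + c * theta c).
Proof.
rewrite -negb_and -suz_N_eq0.
have: suz_N a b = a ^+ 2 * theta a + a * b + theta b by [].
have: theta (suz_N a b) =
    theta a ^+ 2 * a ^+ 2 + theta a * theta b + b ^+ 2.
  by rewrite /suz_N !(expr2, thetaD, thetaM) !thetaK expr2; ring.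
(* [N] and [theta N] stay atoms, and are expanded by [NE] and [tNE] only where an entry depends on
   their values. *)
move: (suz_N a b) => N tNE NE N0 /=.
have tN0 : theta N != 0 by rewrite theta_eq0.
have c2 := suz_two.
have: theta ((a * theta a + b) / N) = (theta a * a ^+ 2 + theta b) / theta N.
  by rewrite !(thetaD, thetaM, thetaV) thetaK.
move cE: ((a * theta a + b) / N) => c tcE.
rewrite /suz_S /suz_T /suz_D !mul_mx4 /= !(thetaD, thetaM, thetaV, thetaK).
have Ncd : c ^+ 2 * theta c + c * (a / N + c * theta c) +
            (theta a / theta N + theta c * c ^+ 2) = N^-1.
  rewrite tcE -cE tNE NE; rewrite NE in N0; rewrite tNE in tN0.
  by field2 c2; rewrite ?exprMn ?N0 ?tN0.
have cd : c * theta c + (a / N + c * theta c) = a / N by ring2 c2.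
have Nab : (b / N) ^+ 2 * (theta b / theta N) + b / N * (a / N) +
            theta a / theta N = N^-1.
  rewrite tNE NE; rewrite NE in N0; rewrite tNE in tN0.
  by field2 c2; rewrite ?exprMn ?N0 ?tN0.
have zE : theta N / N * (N ^+ 2 / theta N) = N.
  by field; rewrite N0 tN0.
rewrite zE Ncd cd Nab.
rewrite !(mul0r, mulr0, add0r, addr0, mulr1, mul1r, mulfVK, mulVf) //.
congr (mx4 [:: [:: _; _; _; _]; [:: _; _; _; _]; [:: _; _; _; _];
              [:: _; _; _; _]]).
all: rewrite // ?tcE -?cE ?tNE ?NE; rewrite NE in N0; rewrite tNE in tN0.
all: (field2 c2; rewrite ?exprMn ?N0 ?tN0 //).
Qed.

End SuzukiMatrices.

End SuzukiMatrix.

Import SuzukiMatrix.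

(** * The generated group and its Bruhat decomposition *)

Module SuzukiGroup.

Set Implicit Arguments.
Unset Strict Implicit.
Unset Printing Implicit Defensive.

Import GroupScope GRing.Theory.
Local Open Scope ring_scope.

(* Naming the group structure keeps unification from unfolding it. *)
Definition GL4 (F : finFieldType) : finGroupType := {'GL_4[F]}.

Section SuzukiGroup.

Variables (p : nat) (F : finFieldType).
Hypotheses (p_odd : odd p) (cardF : #|F| = (2 ^ p)%N).

Local Notation q := (2 ^ p)%N.
Local Notation theta := (@suz_theta F).
Local Notation GL4 := (GL4 F).

Definition suz : {set GL4} := Sz F.

Canonical suz_group := Eval hnf in [group of suz].

Definition toGL (A : 'M[F]_4) : GL4 := locked (insubd (1%g : {'GL_4[F]}) A).

Definition GLmx (g : GL4) : 'M[F]_4 := @GLval 4 F g.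
Arguments GLmx : simpl never.

Lemma GLmxM : {morph GLmx : x y / (x * y)%g >-> x *m y}.
Proof. by []. Qed.

Lemma GLmx1 : GLmx 1%g = 1%:M.
Proof. by []. Qed.

Lemma GLmx_inj : injective GLmx.
Proof. exact: val_inj. Qed.

Lemma toGLK A : A \in unitmx -> GLmx (toGL A) = A.
Proof.
move=> uA; rewrite /toGL -lock /GLmx.
exact: (@insubdK _ _ {'GL_4[F]} 1%g A uA).
Qed.

Definition szS a b := toGL (suz_S a b).
Definition szM z := toGL (suz_D z).
Arguments szS (a b)%_R.
Arguments szM z%_R.
Definition szT := toGL (suz_T F).

Lemma val_szS a b : GLmx (szS a b) = suz_S a b.
Proof. exact/toGLK/suz_S_unit. Qed.

Lemma val_szM z : z != 0 -> GLmx (szM z) = suz_D z.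
Proof.
move=> z0; apply: toGLK.
by rewrite -(suz_M_theta p_odd cardF) suz_M_unit // theta_eq0.
Qed.

Lemma val_szT : GLmx szT = suz_T F.
Proof. exact/toGLK/suz_T_unit. Qed.

Lemma szS_in a b : szS a b \in suz.
Proof.
apply: mem_gen; rewrite inE; apply/or3P/Or31.
by apply/existsP; exists a; apply/existsP; exists b; apply/eqP/val_szS.
Qed.

Lemma szM_in z : z != 0 -> szM z \in suz.
Proof.
move=> z0; apply: mem_gen; rewrite inE; apply/or3P/Or32.
apply/existsP; exists (theta z).
by rewrite theta_eq0 z0 (suz_M_theta p_odd cardF); apply/eqP/val_szM.
Qed.

Lemma szT_in : szT \in suz.
Proof. by apply: mem_gen; rewrite inE; apply/or3P/Or33/eqP/val_szT. Qed.

Lemma szS_mul a b c d :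
  (szS a b * szS c d)%g = szS (a + c) (b + d + theta a * c).
Proof. by apply: GLmx_inj; rewrite GLmxM !val_szS -(mul_suz_S p_odd cardF). Qed.

Lemma szS0 : szS 0 0 = 1%g.
Proof. by apply: GLmx_inj; rewrite val_szS suz_S0. Qed.

Lemma szM_mul z w : z != 0 -> w != 0 -> (szM z * szM w)%g = szM (z * w).
Proof.
move=> z0 w0; apply: GLmx_inj.
by rewrite GLmxM !val_szM ?mulf_neq0 // -mul_suz_D.
Qed.

Lemma szM1 : szM 1 = 1%g.
Proof.
apply: (@mulgI _ (szM 1)); rewrite mulg1.
by rewrite szM_mul ?oner_eq0 // mulr1.
Qed.

Lemma szM_S z a b : z != 0 ->
  (szM z * szS a b)%g = (szS (a / theta z) (b / (z ^+ 2 * theta z)) * szM z)%g.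
Proof.
move=> z0; apply: GLmx_inj.
by rewrite !GLmxM !val_szS !val_szM // -(mul_suz_D_S p_odd cardF).
Qed.

Lemma szS_M z a b : z != 0 ->
  (szS a b * szM z)%g = (szM z * szS (a * theta z) (b * (z ^+ 2 * theta z)))%g.
Proof.
by move=> z0; rewrite szM_S // !mulfK // ?mulf_neq0 ?expf_neq0 ?theta_eq0.
Qed.

Lemma szT_M z : z != 0 -> (szT * szM z)%g = (szM z^-1 * szT)%g.
Proof.
move=> z0; apply: GLmx_inj; rewrite ?GLmxM val_szT !val_szM ?invr_eq0 //.
by rewrite -mul_suz_T_D.
Qed.

Lemma szT_T : (szT * szT)%g = 1%g.
Proof. by apply: GLmx_inj; rewrite GLmxM val_szT mul_suz_T. Qed.

(** This is [suz_T_S_T] with the last [szT] carried to the other side, ready for multiplication by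
    [szT] on the left. *)
Lemma szT_S a b : (a != 0) || (b != 0) ->
  exists c d z a' b', z != 0 /\
    (szT * szS a b)%g = (szS c d * szM z * szT * szS a' b' * szT)%g.
Proof.
move=> ab0; set N := suz_N a b.
have N0 : N != 0 by rewrite (suz_N_eq0 p_odd cardF) negb_and.
have z0 : theta N / N != 0 by rewrite mulf_neq0 ?invr_eq0 ?theta_eq0.
do 5!eexists; split; first exact: z0.
apply: (@mulIg _ szT); rewrite -[RHS]mulgA szT_T mulg1.
apply: GLmx_inj; rewrite ?GLmxM val_szT !val_szS !val_szM //.
exact: (suz_T_S_T p_odd cardF).
Qed.

Definition borel : {set GL4} :=
  [set (szS x.1.1 x.1.2 * szM x.2)%g | x : F * F * F & x.2 != 0].

Definition big_cell : {set GL4} :=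
  [set (b * szT * szS x.1 x.2)%g | b in borel, x in [set: F * F]].

Lemma borelP g :
  reflect (exists a b z, z != 0 /\ g = (szS a b * szM z)%g) (g \in borel).
Proof.
apply: (iffP imsetP) => [[[[a b] z]] | [a [b [z [z0 ->]]]]].
  by rewrite inE => z0 ->; exists a, b, z.
by exists (a, b, z); rewrite ?inE.
Qed.

Lemma big_cellP g :
  reflect (exists a b z c d, z != 0 /\
    g = (szS a b * szM z * szT * szS c d)%g) (g \in big_cell).
Proof.
apply: (iffP imset2P) => [[b [c d] Bb _ ->] | [a [b [z [c [d [z0 ->]]]]]]].
  by case/borelP: Bb => a [b' [z [z0 ->]]]; exists a, b', z, c, d.
exists (szS a b * szM z)%g (c, d); rewrite ?inE //.
by apply/borelP; exists a, b, z.
Qed.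

Lemma borel_gen g a b z :
  z != 0 -> g \in borel -> (szS a b * szM z * g)%g \in borel.
Proof.
move=> z0 /borelP[c [d [w [w0 ->]]]]; apply/borelP.
rewrite !mulgA -[(_ * _ * szS c d)%g]mulgA szM_S // mulgA szS_mul -mulgA.
rewrite szM_mul //.
by do 3!eexists; split; last reflexivity; apply: mulf_neq0.
Qed.

Lemma big_cell_gen g a b z : z != 0 ->
  g \in big_cell -> (szS a b * szM z * g)%g \in big_cell.
Proof.
move=> z0 /imset2P[h x Bh _ ->]; rewrite !mulgA.
by apply: imset2_f => //; apply: borel_gen.
Qed.

(** The union contains 1 and is stable under left multiplication by every generator, so it contains
    the generated group. *)
Lemma bruhat : suz = borel :|: big_cell.
Proof.
apply/eqP; rewrite eqEsubset; apply/andP; split; last first.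
  apply/subsetP => g /setUP[/borelP | /big_cellP].
    by case=> a [b [z [z0 ->]]]; rewrite groupM ?szS_in ?szM_in.
  case=> a [b [z [c [d [z0 ->]]]]].
  by rewrite !groupM ?szS_in ?szM_in ?szT_in.
have W1 : 1%g \in borel.
  apply/borelP; exists 0, 0, 1; rewrite oner_eq0; split=> //.
  by rewrite szS0 szM1 mulg1.
have gen_l a b z g : z != 0 -> g \in borel :|: big_cell ->
    (szS a b * szM z * g)%g \in borel :|: big_cell.
  move=> z0 /setUP[Wg | Wg]; apply/setUP; [left | right].
    exact: borel_gen.
  exact: big_cell_gen.
have szT_l g : g \in borel :|: big_cell -> (szT * g)%g \in borel :|: big_cell.
  case/setUP=> [/borelP[a [b [z [z0 ->]]]] | /big_cellP].
    apply/setUP/or_intror/big_cellP; rewrite szS_M // mulgA szT_M //.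
    exists 0, 0, z^-1; do 2!eexists; rewrite invr_eq0 szS0 mul1g; split=> //.
  case=> a [b [z [c [d [z0 ->]]]]].
  have Tz : (szM z * szT = szT * szM z^-1)%g by rewrite szT_M ?invr_eq0 // invrK.
  have zV0 : z^-1 != 0 by rewrite invr_eq0.
  (* If the unipotent factor between the two copies of [szT] is trivial, they cancel and the product
     falls into the Borel subgroup; otherwise [szT_S] brings it back to the big cell. *)
  have [/orP ab0 | /norP[]] := boolP ((a != 0) || (b != 0)); last first.
    rewrite !negbK => /eqP-> /eqP->; rewrite szS0 mul1g.
    rewrite Tz !mulgA szT_T mul1g szM_S //; apply/setUP/or_introl/borelP.
    by do 3!eexists; split; last reflexivity.
  have [a1 [b1 [w [c1 [d1 [w0 E]]]]]] := szT_S (introT orP ab0).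
  apply/setUP/or_intror.
  have -> : (szT * (szS a b * szM z * szT * szS c d) =
      szS a1 b1 * szM w * szT * (szS c1 d1 * szM z^-1) * szS c d)%g.
    transitivity (szT * szS a b * (szM z * szT) * szS c d)%g.
      by rewrite !mulgA.
    by rewrite E Tz !mulgA -[(_ * szT * szT)%g]mulgA szT_T mulg1.
  rewrite (szS_M c1 d1 zV0) !mulgA -[(_ * szT * szM _)%g]mulgA szT_M //.
  rewrite invrK !mulgA.
  rewrite -[(_ * szM w * szM z)%g]mulgA szM_mul // -[X in X \in _]mulgA szS_mul.
  by apply/big_cellP; do 5!eexists; split; last reflexivity; apply: mulf_neq0.
apply/subsetP => _ /gen_prodgP[n [c genc ->]].
elim: n => [|n IHn] in c genc *; first by rewrite big_ord0 inE W1.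
rewrite big_ord_recl; set g := (\prod_(i < n) _)%g.
have {IHn} : g \in borel :|: big_cell by apply: IHn => i; apply: genc.
move: g (genc ord0) => g; rewrite inE => /or3P[].
- case/existsP=> a /existsP[b /eqP E] Wg.
  have -> : c ord0 = (szS a b * szM 1)%g.
    by rewrite szM1 mulg1; apply: GLmx_inj; rewrite [LHS]E val_szS.
  by apply: gen_l; rewrite ?oner_eq0.
- case/existsP=> l /andP[l0 /eqP E] Wg.
  (* This power inverts [theta], so the generator [suz_M l] is [suz_D z]. *)
  pose z := l ^+ (2 ^ suz_n F).
  have z0 : z != 0 by rewrite expf_neq0.
  have -> : c ord0 = (szS 0 0 * szM z)%g.
    rewrite szS0 mul1g; apply: GLmx_inj; rewrite [LHS]E val_szM //.
    by rewrite -(suz_M_theta p_odd cardF) (theta_expk p_odd cardF).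
  exact: gen_l.
- move=> /eqP E; have -> : c ord0 = szT; last exact: szT_l.
  by apply: GLmx_inj; rewrite [LHS]E val_szT.
Qed.

End SuzukiGroup.

(** For the big cell: the factor s commutes with u and cancels, which leaves a relation between h, u
    and the conjugate of u by t. *)
Lemma commute_conj_involution (gT : finGroupType) (h t s u : gT) :
  (u * (h * t * s) = h * t * s * u -> t * t = 1 -> u * s = s * u ->
   h * (t * u * t) = u * h)%g.
Proof.
move=> E tt us; apply: (@mulIg _ (t * s)%g); rewrite !mulgA in E *.
by rewrite E -!mulgA (mulgA t t) tt mul1g us.
Qed.

Lemma commute_mulKl (gT : finGroupType) (h m u : gT) :
  (h * m * u = u * (h * m) -> u * h = h * u -> m * u = u * m)%g.
Proof. by move=> E uh; apply: (@mulgI _ h); rewrite !mulgA E mulgA uh. Qed.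

(** * The order of the group, and centralisers inside its Sylow 2-subgroup *)

Section SuzukiOrder.

Variables (p : nat) (F : finFieldType).
Hypotheses (p_odd : odd p) (cardF : #|F| = (2 ^ p)%N).

Local Notation q := (2 ^ p)%N.
Local Notation theta := (@suz_theta F).
Local Notation GL4 := (GL4 F).
Local Notation suz := (suz F).
Local Notation szS := (@szS F).
Local Notation szM := (@szM F).
Local Notation szT := (szT F).
Local Notation i1 := (Ordinal (isT : (1 < 4)%N)).
Local Notation i2 := (Ordinal (isT : (2 < 4)%N)).
Local Notation i3 := (Ordinal (isT : (3 < 4)%N)).

Lemma szS_inj a b c d : szS a b = szS c d -> a = c /\ b = d.
Proof.
move/(congr1 (@GLmx F)); rewrite !val_szS => /matrixP E.
by move: (E i1 ord0) (E i2 ord0); rewrite !mxE.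
Qed.

Lemma szM_inj z w : z != 0 -> w != 0 -> szM z = szM w -> z = w.
Proof.
move=> z0 w0 /(congr1 (@GLmx F)); rewrite !(val_szM p_odd cardF) //.
by move/matrixP/(_ i1 i1); rewrite !mxE.
Qed.

Lemma borel_mx a b z : z != 0 ->
  [/\ forall j, GLmx (szS a b * szM z)%g ord0 j = (z * theta z) *+ (j == ord0),
      GLmx (szS a b * szM z)%g i1 i1 = z,
      GLmx (szS a b * szM z)%g i1 ord0 = a * (z * theta z) &
      GLmx (szS a b * szM z)%g i2 ord0 = b * (z * theta z)].
Proof.
move=> z0; rewrite GLmxM val_szS (val_szM p_odd cardF) // mul_mx4 /=.
split; first case=> [[|[|[|[|j]]]] hj] //=.
all: by rewrite mxE /= !(mul0r, mulr0, addr0, add0r, mul1r).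
Qed.

(** Borel elements are lower triangular, so the first row of the product involves only the first row
    of [A]. *)
Lemma borel_row g (A : 'M[F]_4) : g \in borel F ->
  exists2 x, x != 0 & forall j, (GLmx g *m A) ord0 j = x * A ord0 j.
Proof.
case/borelP=> a [b [z [z0 ->]]]; have [row0 _ _ _] := borel_mx a b z0.
exists (z * theta z) => [|j]; first by rewrite mulf_neq0 ?theta_eq0.
rewrite mxE (bigD1 ord0) //= row0 eqxx big1 ?addr0 // => i /negbTE i0.
by rewrite row0 i0 mul0r.
Qed.

Lemma suz_T_row (A : 'M[F]_4) i j : (suz_T F *m A) i j = A (rev_ord i) j.
Proof.
rewrite mxE (bigD1 (rev_ord i)) //= [X in X * _](_ : _ = 1).
  rewrite mul1r big1 ?addr0 // => i'.
  by case: i i' => [[|[|[|[|i]]]] hi] [[|[|[|[|i']]]] hi'] //= _;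
     rewrite mxE /= mul0r.
by case: i => [[|[|[|[|i]]]] hi] //=; rewrite mxE.
Qed.

(** [szT] reverses rows, so the first row is a multiple of the last row of [suz_S c d]. It
    determines c and d, and its nonzero last entry separates the big cell from the Borel
    subgroup. *)
Lemma big_cell_row g c d : g \in borel F ->
  let u := GLmx (g * szT * szS c d)%g in
  exists2 x, x != 0 & [/\ u ord0 i3 = x, u ord0 i2 = x * c
                        & u ord0 i1 = x * (c * theta c + d)].
Proof.
move=> Bg u; rewrite {}/u -mulgA GLmxM.
have [x x0 row0] := borel_row (GLmx (szT * szS c d)%g) Bg.
exists x => //; rewrite !row0 GLmxM val_szT val_szS !suz_T_row.
by rewrite !mxE /= mulr1.
Qed.

Lemma card_borel : #|borel F| = (q ^ 2 * (q - 1))%N.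
Proof.
rewrite card_in_imset => [|[[a b] z] [[c d] w]]; last first.
  rewrite !inE /= => z0 w0 E.
  have [_ z11 a10 b20] := borel_mx a b z0.
  have [_ w11 c10 d20] := borel_mx c d w0.
  have zw : z = w by rewrite -z11 E.
  have zt0 : z * theta z != 0 by rewrite mulf_neq0 ?theta_eq0.
  have ac : a = c by apply: (mulIf zt0); rewrite -a10 E c10 zw.
  have bd : b = d by apply: (mulIf zt0); rewrite -b20 E d20 zw.
  by rewrite zw ac bd.
have -> : #|[set x : F * F * F | x.2 != 0]| =
    #|setX [set: F * F] [set~ (0 : F)]|.
  by apply: eq_card => x; rewrite !inE.
by rewrite cardsX cardsT card_prod cardF cardsC1 cardF mulnn subn1.
Qed.

Lemma card_big_cell : #|big_cell F| = (q ^ 2 * (q - 1) * q ^ 2)%N.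
Proof.
rewrite /big_cell curry_imset2X card_in_imset => [|[h [c d]] [h' [c' d']]].
  by rewrite cardsX card_borel cardsT card_prod cardF mulnn.
rewrite !in_setX !inE !andbT /= => Bh Bh' E.
have [x x0 [Ex Exc Exd]] := big_cell_row c d Bh.
have [x' x'0 [Ex' Exc' Exd']] := big_cell_row c' d' Bh'.
rewrite E in Ex Exc Exd.
have xx' : x = x' by rewrite -Ex Ex'.
have cc' : c = c' by apply: (mulfI x0); rewrite -Exc Exc' xx'.
have dd' : d = d'.
  apply: (@addrI _ (c * theta c)); apply: (mulfI x0).
  by rewrite -Exd Exd' xx' cc'.
by move: E; rewrite cc' dd' => /mulIg/mulIg ->.
Qed.

Lemma borel_big_cell_disjoint : [disjoint borel F & big_cell F].
Proof.
apply/pred0P => g /=; apply/negP => /andP[Bg].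
case/imset2P=> h [c d] Bh _ E; have [x x0 [Ex _ _]] := big_cell_row c d Bh.
case/eqP: x0; rewrite -Ex -E; case/borelP: Bg => a [b [z [z0 ->]]].
by have [-> _ _ _] := borel_mx a b z0.
Qed.

Lemma card_Sz : #|suz| = (q ^ 2 * (q - 1) * (q ^ 2 + 1))%N.
Proof.
rewrite (bruhat p_odd cardF) cardsU.
have := borel_big_cell_disjoint; rewrite -setI_eq0 => /eqP ->.
rewrite cards0 subn0 card_borel card_big_cell.
by rewrite mulnDr muln1 addnC.
Qed.

(** The unipotent part of the Borel subgroup, a Sylow 2-subgroup of the Suzuki group; [suz_H] is its
    diagonal complement. *)
Definition suz_Q : {set GL4} := [set szS x.1 x.2 | x in [set: F * F]].
Definition suz_H : {set GL4} := [set szM z | z in [set~ 0]].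

Lemma mem_suz_Q a b : szS a b \in suz_Q.
Proof. by apply/imsetP; exists (a, b). Qed.

Lemma suz_Q_group_set : group_set suz_Q.
Proof.
apply/group_setP; split; first by rewrite -(szS0 F) mem_suz_Q.
move=> _ _ /imsetP[[a b] _ ->] /imsetP[[c d] _ ->] /=.
by rewrite (szS_mul p_odd cardF) mem_suz_Q.
Qed.

Lemma suz_H_group_set : group_set suz_H.
Proof.
apply/group_setP; split.
  by apply/imsetP; exists 1; rewrite ?inE ?oner_eq0 // (szM1 p_odd cardF).
move=> _ _ /imsetP[z z0 ->] /imsetP[w w0 ->]; rewrite !inE in z0 w0.
rewrite (szM_mul p_odd cardF) //; apply/imsetP; exists (z * w) => //.
by rewrite !inE mulf_neq0.
Qed.

Lemma card_suz_Q : #|suz_Q| = (q ^ 2)%N.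
Proof.
rewrite card_in_imset => [|[a b] [c d] _ _ /= /szS_inj[-> ->] //].
by rewrite cardsT card_prod cardF mulnn.
Qed.

Lemma card_suz_H : #|suz_H| = (q - 1)%N.
Proof.
rewrite card_in_imset => [|z w]; first by rewrite cardsC1 cardF subn1.
by rewrite !inE; apply: szM_inj.
Qed.

Lemma suz_Q_sub : suz_Q \subset suz.
Proof. by apply/subsetP => _ /imsetP[[a b] _ ->]; apply: szS_in. Qed.

Lemma suz_H_sub : suz_H \subset suz.
Proof.
apply/subsetP => _ /imsetP[z z0 ->]; rewrite !inE in z0.
exact: (szM_in p_odd cardF z0).
Qed.

Lemma szS0_central a b c : (szS 0 b * szS a c = szS a c * szS 0 b)%g.
Proof.
by rewrite !(szS_mul p_odd cardF) theta0 mul0r mulr0 add0r addr0 !addr0 addrC.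
Qed.

(** In the Borel subgroup, commuting with [szS 0 b] forces the diagonal part to be 1. An element of
    the big cell would conjugate a lower triangular matrix to one with a nonzero upper right
    entry. *)
Lemma cent_szS0 b : b != 0 -> 'C_(suz)[szS 0 b]%g \subset suz_Q.
Proof.
move=> b0; have tb0 : theta b != 0 by rewrite theta_eq0.
apply/subsetP => g; rewrite inE (bruhat p_odd cardF) => /andP[/setUP[|] + /cent1P].
- case/borelP=> a [c [z [z0 ->]]] E.
  have {E} : (szM z * szS 0 b = szS 0 b * szM z)%g.
    exact: commute_mulKl E (szS0_central a b c).
  rewrite (szM_S p_odd cardF) // => /mulIg/szS_inj[_ Eb].
  have tz0 : theta z != 0 by rewrite theta_eq0.
  have z1 : z ^+ 2 * theta z = 1.
    apply: (mulfI b0); rewrite -{1}Eb divfK ?mulr1 //.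
    by rewrite mulf_neq0 ?expf_neq0.
  have c2 := suz_two cardF.
  (* Applying [theta] to [z1] shows that the square of z * theta z is 1, and squaring is injective
     in characteristic 2. With [z1] this gives z = 1. *)
  have : (z * theta z - 1) ^+ 2 = 0.
    have := congr1 theta z1; rewrite theta1 expr2 !thetaM (thetaK p_odd cardF).
    move=> z2; rewrite sqrrB expr1n -mulr_natr c2 !(mulr0, subr0) exprMn.
    by rewrite mulrC [theta z ^+ 2]expr2 z2 -mulr2n c2.
  move/eqP; rewrite expf_eq0 /= subr_eq0 => /eqP z2.
  have -> : z = 1 by rewrite -z1 expr2 -mulrA z2 mulr1.
  by rewrite (szM1 p_odd cardF) mulg1 mem_suz_Q.
- case/imset2P=> h [c d] Bh _ -> /= E.
  have {E} : (h * (szT * szS 0 b * szT) = szS 0 b * h)%g.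
    exact: commute_conj_involution (esym E) (szT_T F) (szS0_central c b d).
  (* The upper right entries are compared: a nonzero multiple of [theta b] on the left, and 0 on the
     right, where both factors are lower triangular. *)
  move/(congr1 (fun u : GL4 => GLmx u ord0 i3)).
  have [x x0 row0] := borel_row (GLmx (szT * szS 0 b * szT)%g) Bh.
  rewrite GLmxM row0 !GLmxM val_szT !val_szS -mulmxA suz_T_row.
  have h03 : GLmx h ord0 i3 = 0.
    case/borelP: Bh => a [b' [z [z0 ->]]]; have [h0 _ _ _] := borel_mx a b' z0.
    exact: h0.
  have -> : (suz_S 0 b *m GLmx h) ord0 i3 = 0.
    rewrite mxE (bigD1 ord0) //= h03 mulr0 add0r big1 // => i /negbTE i0.
    by case: i i0 => [[|[|[|[|i]]]] hi] //= _; rewrite mxE /= mul0r.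
  rewrite /suz_T /suz_S mul_mx4 mxE /= theta0 expr0n /=.
  rewrite !(mul0r, mulr0, mulr1, mul1r, addr0, add0r).
  by move/eqP; rewrite mulf_eq0 (negbTE x0) (negbTE tb0).
Qed.

End SuzukiOrder.

End SuzukiGroup.

Import SuzukiGroup.

(** * Torus elements and their centralisers *)

Module Tori.

Set Implicit Arguments.
Unset Strict Implicit.
Unset Printing Implicit Defensive.

Import GRing.Theory.
Local Open Scope ring_scope.
Import GroupScope.

(** [C] acts by conjugation on its conjugates other than itself. All stabilisers are trivial, so
    every orbit has #|C| elements. *)
Lemma index_norm_TI (gT : finGroupType) (G C : {group gT}) : C \subset G ->
  {in G, forall g, C :^ g != C -> 'N_C(C :^ g) = 1} ->
  (#|C| %| #|G : 'N_G(C)| - 1)%N.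
Proof.
move=> sCG TI; rewrite -card_conjugates (cardsD1 (C : {set gT})).
have -> : (C : {set gT}) \in C :^: G by apply: orbit_refl.
rewrite addKn; set S := _ :\ _.
have actS : [acts C, on S | 'Js].
  apply/subsetP=> c Cc; rewrite !inE /=; apply/subsetP=> X.
  rewrite !inE /= => /andP[XC /imsetP[g Gg XE]]; apply/andP; split.
    apply: contraNneq XC => XcC.
    by rewrite -(conjsgK c X) XcC conjGid ?groupV.
  apply/imsetP; exists (g * c); first by rewrite groupM // (subsetP sCG).
  by rewrite XE conjsgM.
rewrite -(acts_sum_card_orbit actS); apply: dvdn_sum => _ /imsetP[X + ->].
rewrite !inE => /andP[XC /imsetP[g Gg XE]].
rewrite card_orbit astab1Js XE TI ?indexg1 //.
by rewrite -[C :^ g]XE.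
Qed.

Section Torus.

Variables (p : nat) (F : finFieldType) (gT : finGroupType) (G : {group gT}).
Variable rG : mx_representation F G 4.
Local Notation q := (2 ^ p)%N.

Hypotheses (p_odd : odd p) (p_gt2 : (2 < p)%N) (cardF : #|F| = q).
Hypotheses (faithG : mx_faithful rG) (Z1 : 'Z(G) = 1).
Hypothesis cardG : #|G| = (q ^ 2 * (q - 1) * (q ^ 2 + 1))%N.

Lemma q_gt7 : (7 < q)%N.
Proof. by apply: (@leq_trans (2 ^ 3)%N) => //; apply: leq_pexp2l. Qed.

Lemma q_even : ~~ odd q.
Proof. by rewrite oddX; case: (p) p_gt2. Qed.

Lemma q_mod3 : (q %% 3 = 2)%N.
Proof.
rewrite -[p]odd_double_half p_odd expnS -mul2n expnM.
by rewrite -modnMmr -modnXm exp1n.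
Qed.

(** Modulo l the square of q is -1 and l is odd, so q has order 4. The prime 3 is excluded because q
    is 2 modulo 3. *)
Lemma prime_dvd_q2D1 l : prime l -> (l %| q ^ 2 + 1)%N ->
  [/\ (4 < l)%N, ~~ (l %| q)%N, ~~ (l %| q - 1)%N
    & forall i, (0 < i < 4)%N -> ~~ (l %| q ^ i - 1)%N].
Proof.
move=> l_pr l_dv; have q7 := q_gt7; have l_gt1 := prime_gt1 l_pr.
have l2 : l != 2.
  apply: contraTneq l_dv => ->; rewrite dvdn2 oddD oddX (negbTE q_even) //=.
have l3 : l != 3.
  apply: contraTneq l_dv => ->; rewrite /dvdn -modnDml -modnXm q_mod3 //.
have l4 : l != 4 by apply: contraTneq l_pr => ->.
have l_gt4 : (4 < l)%N by lia.
have lq : ~~ (l %| q)%N.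
  apply/negP=> dv; have := dvdn_sub l_dv (dvdn_mulr q dv).
  by rewrite mulnn addKn dvdn1; lia.
have n2 : ~~ (l %| q ^ 2 - 1)%N.
  apply/negP=> /(dvdn_sub l_dv); rewrite (_ : _ - _ = 2)%N; last first.
    by have : (0 < q ^ 2)%N; [rewrite !expn_gt0 | move: (q ^ 2)%N => Q; lia].
  by rewrite dvdn_prime2 // (negbTE l2).
have nq i : (0 < i < 4)%N -> ~~ (l %| q ^ i - 1)%N.
  case: i => [|[|[|[|i]]]] // _; apply: contra n2 => dvi.
    by apply: dvdn_trans dvi _; rewrite !subn1 expn1 dvdn_pred_predX.
  (* Here i = 3, and q (q ^ 2 + 1) - (q ^ 3 - 1) = q + 1. *)
  have dv : (l %| q + 1)%N.
    have := dvdn_sub (dvdn_mull q l_dv) dvi.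
    have q3 : (0 < q ^ 3)%N by rewrite !expn_gt0.
    rewrite mulnDr muln1 -expnS; congr (_ %| _)%N.
    by move: (q ^ 3)%N q3; clear; lia.
  by rewrite -[in X in (_ %| _ - X)%N](exp1n 2) subn_sqr dvdn_mull.
by split=> //; apply: (nq 1%N isT).
Qed.

Definition torus_elt y := [&& y \in G, prime #[y] & (#[y] %| q ^ 2 + 1)%N].

(** The fixed space [W] of y is 0, by the rank dichotomy [rk] applied to the whole space; then [rk]
    for [U] leaves only the ranks 0 and 4. *)
Lemma torus_stable_rank y (U : 'M[F]_4) :
  torus_elt y -> (U *m rG y <= U)%MS -> (\rank U == 0%N) || (\rank U == 4).
Proof.
case/and3P=> Gy l_pr l_dv; set l := #[y] in l_pr l_dv.
have [_ lq _ nq] := prime_dvd_q2D1 l_pr l_dv.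
pose W := kermx (rG y - 1%:M).
have sYG : <[y]> \subset G by rewrite cycle_subG.
have fixE (V : 'M[F]_4) : 'Fix_(rowg V | 'MR rG)(<[y]>) = rowg (V :&: W)%MS.
  apply/setP=> u; rewrite in_setI ![u \in rowg _]inE sub_capmx; congr (_ && _).
  apply/afixP/idP => [/(_ y (cycle_id y)) | ].
    rewrite /= mx_repr_actE // => E; apply/sub_kermxP.
    by rewrite mulmxBr mulmx1 E subrr.
  move/sub_kermxP => E _ /cycleP[i ->]; rewrite /= mx_repr_actE ?groupX //.
  elim: i => [|i IHi]; first by rewrite repr_mx1 mulmx1.
  rewrite expgSr repr_mxM ?groupX // mulmxA IHi.
  by move/eqP: E; rewrite mulmxBr mulmx1 subr_eq0 => /eqP.
(* Counting the fixed points of the l-group generated by y on V modulo l gives that l divides q ^ (d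
   - e) - 1, where d and e are the ranks of V and of its fixed part. As q has order 4 modulo l, d -
   e is 0 or 4. *)
have rk (V : 'M[F]_4) : (V *m rG y <= V)%MS ->
    (\rank V == \rank (V :&: W)%MS) || (\rank V == \rank (V :&: W)%MS + 4)%N.
  move=> sV; have leVW := mxrankS (capmxSl V W).
  have actV : [acts <[y]>, on rowg V | 'MR rG].
    rewrite cycle_subG !inE Gy; apply/subsetP=> u; rewrite !inE /= => Vu.
    by rewrite mx_repr_actE //; apply: submx_trans (submxMr _ Vu) sV.
  have lY : l.-group <[y]> by rewrite /pgroup -orderE -/l pnat_id.
  have := pgroup_fix_mod lY actV; rewrite fixE !card_rowg cardF.
  set d := \rank V in leVW *; set e := \rank _ in leVW *.
  have led : (d <= 4)%N by apply: rank_leq_row.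
  move/eqP; rewrite eqn_mod_dvd; last by rewrite leq_pexp2l ?expn_gt0.
  rewrite -{1}(subnKC leVW) expnD -[X in (_ - X)%N]muln1 -mulnBr.
  rewrite Euclid_dvdM // [X in X || _](_ : _ = false); last first.
    by apply: contraNF lq; rewrite Euclid_dvdX // => /andP[].
  have [-> | de] := eqVneq d e; first by [].
  have [de4 | de4] := eqVneq (d - e)%N 4.
    by rewrite -(subnKC leVW) de4 eqxx orbT.
  rewrite (negbTE (nq _ _)) // subn_gt0 ltn_neqAle eq_sym de leVW.
  by rewrite ltn_neqAle de4 (leq_trans (leq_subr e d) led).
have W0 : \rank W = 0%N.
  have := rk 1%:M; rewrite submx1 mxrank1 cap1mx => /(_ isT).
  have leW : (\rank W <= 4)%N by apply: rank_leq_row.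
  case/orP=> /eqP W4; last by lia.
  have W1 : (1%:M <= W)%MS.
    by rewrite sub1mx row_full_unit -row_free_unit /row_free -W4.
  move/sub_kermxP: W1; rewrite mul1mx => /eqP; rewrite subr_eq0 => /eqP y1.
  have : y \in rker rG by apply/rkerP.
  by rewrite (trivgP faithG) => /set1P y1'; move: l_pr; rewrite /l y1' order1.
move=> /rk; suff -> : \rank (U :&: W)%MS = 0%N by rewrite add0n.
by apply/eqP; rewrite -leqn0 (leq_trans (mxrankS (capmxSr U W))) // W0.
Qed.

(** Schur's lemma: the kernel of [A] is stable under y, hence 0 or everything. *)
Lemma torus_comm_unit y (A : 'M[F]_4) :
  torus_elt y -> A *m rG y = rG y *m A -> A != 0 -> A \in unitmx.
Proof.
move=> Ty cAy A0; rewrite -row_free_unit -kermx_eq0.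
have : (kermx A *m rG y <= kermx A)%MS.
  by apply/sub_kermxP; rewrite -mulmxA -cAy mulmxA mulmx_ker mul0mx.
case/(torus_stable_rank Ty)/orP=> [|/eqP]; first by rewrite mxrank_eq0.
rewrite mxrank_ker => rk4; case/eqP: A0; apply/eqP; rewrite -mxrank_eq0.
by have := rank_leq_row A; move: rk4; case: (\rank A) => [|[|[|[|[|r]]]]].
Qed.

(* Every vector generates the whole space over F[y], so A agrees at one vector
   with a polynomial in y, hence everywhere. *)
Lemma torus_comm_comm y (A B : 'M[F]_4) : torus_elt y ->
  A *m rG y = rG y *m A -> B *m rG y = rG y *m B -> A *m B = B *m A.
Proof.
move=> Ty cA cB; have /and3P[Gy _ _] := Ty.
have sYG : <[y]> \subset G by rewrite cycle_subG.
pose rY := subg_repr rG sYG.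
pose v : 'rV[F]_4 := delta_mx 0%R 0%R.
have v0 : v != 0%R.
  by apply/eqP=> /matrixP/(_ 0%R 0%R)/eqP; rewrite !mxE !eqxx oner_eq0.
have cent C : C *m rG y = rG y *m C -> centgmx rY C.
  move=> cC; apply/centgmxP=> _ /cycleP[i ->] /=.
  elim: i => [|i IHi]; first by rewrite expg0 repr_mx1 mulmx1 mul1mx.
  by rewrite expgS repr_mxM ?groupX // mulmxA cC -!mulmxA IHi.
have full : row_full (cyclic_mx rY v).
  have /mxmoduleP/(_ y (cycle_id y))/= := cyclic_mx_module rY v.
  case/(torus_stable_rank Ty)/orP => // /eqP.
  by move/eqP; rewrite mxrank_eq0 cyclic_mx_eq0 (negbTE v0).
have /cyclic_mxP[A' E_A' EA] : (v *m A <= cyclic_mx rY v)%MS.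
  exact: submx_full.
have cA'y : A' *m rG y = rG y *m A'.
  apply/esym; move: (cent _ (erefl (rG y *m rG y))).
  rewrite -memmx_cent_envelop.
  by move/cent_mxP/(_ _ E_A').
have AA' : A = A'.
  apply/eqP; rewrite -subr_eq0; apply/negPn/negP => nz.
  have uA : (A - A')%R \in unitmx.
    by apply: torus_comm_unit Ty _ nz; rewrite mulmxBl mulmxBr cA cA'y.
  case/eqP: v0; rewrite -[v](mulmxK uA) mulmxBr EA subrr mul0mx //.
rewrite AA'; move: (cent _ cB); rewrite -memmx_cent_envelop.
by move/cent_mxP/(_ _ E_A').
Qed.

Lemma repr_comm y z : y \in G -> z \in G ->
  (rG y *m rG z == rG z *m rG y) = (y * z == z * y).
Proof.
move=> Gy Gz; rewrite -!repr_mxM //.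
by apply/eqP/eqP => [/(mx_faithful_inj faithG) | -> //]; apply; rewrite groupM.
Qed.

Lemma torus_cent_abelian y : torus_elt y -> abelian 'C_G[y].
Proof.
move=> Ty; have /and3P[Gy _ _] := Ty.
apply/centsP=> a /setIP[Ga /cent1P cay] b /setIP[Gb /cent1P cby].
apply/eqP; rewrite -repr_comm //; apply/eqP.
by apply: (torus_comm_comm Ty); apply/eqP; rewrite repr_comm //; apply/eqP.
Qed.

(** As the centre is trivial, z is not scalar, so by Schur's lemma z - c is invertible for every c
    in [F]. This rules out order 2, where z - 1 has square 0, and orders dividing q - 1. *)
Lemma torus_cent_prime y z :
  torus_elt y -> z \in 'C_G[y] -> prime #[z] -> torus_elt z.
Proof.
move=> Ty /setIP[Gz /cent1P cyz] z_pr; have /and3P[Gy _ _] := Ty.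
rewrite /torus_elt Gz z_pr /=.
have czy : rG z *m rG y = rG y *m rG z.
  by apply/eqP; rewrite repr_comm //; apply/eqP.
have z1 : z != 1 by apply: contraTneq z_pr => ->; rewrite order1.
have scal c : rG z != c%:M.
  apply: contraNneq z1 => zc.
  suff : z \in 'Z(G) by rewrite Z1 => /set1P->.
  rewrite inE Gz; apply/centP=> g Gg.
  by apply/eqP; rewrite -repr_comm // zc scalar_mxC.
have unit_sub c : rG z - c%:M \in unitmx.
  apply: (torus_comm_unit Ty); last by rewrite subr_eq0.
  by rewrite mulmxBl mulmxBr czy scalar_mxC.
have z_dv : (#[z] %| #|G|)%N by apply: order_dvdG.
move: z_dv; rewrite cardG Euclid_dvdM // Euclid_dvdM // => /orP[/orP[] | //] z_dv.
  have z2 : #[z] = 2%N.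
    move: z_dv; rewrite -expnM Euclid_dvdX // => /andP[+ _].
    by rewrite dvdn_prime2 // => /eqP.
  have c2 : 2 \in [pchar F] := card_finPcharP cardF (isT : prime 2).
  have : (rG z - 1%:M) *m (rG z - 1%:M) = 0.
    rewrite mulmxBr mulmx1 mulmxBl mul1mx -repr_mxM //.
    have -> : z * z = 1 by rewrite -(expg_order z) z2.
    rewrite repr_mx1.
    have -> : 1%:M - rG z = - (rG z - 1%:M) by rewrite opprB.
    rewrite -opprD -mulr2n -scaler_nat; case/andP: c2 => _ /eqP ->.
    by rewrite scale0r oppr0.
  move/(congr1 (mulmx (invmx (rG z - 1%:M)))).
  rewrite mulKmx ?unit_sub // mulmx0 => E.
  by move: (unit_sub 1%R); rewrite E unitmxE det0 unitr0.
(* X ^ q - X is the product of the X - c over [F]. Evaluated at z it is 0, although each factor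
   becomes invertible. *)
have zq : (rG z ^+ q = rG z)%R.
  have zq1 : z ^+ q = z.
    rewrite -[q](subnK (leq_trans (isT : 0 < 7)%N (ltnW q_gt7))) expgD expg1.
    by case/dvdnP: z_dv => i ->; rewrite mulnC expgM expg_order expg1n mul1g.
  by rewrite -repr_mxX // zq1.
have := congr1 (horner_mx (rG z)) (finField_genPoly F).
rewrite rmorphB rmorphXn /= horner_mx_X cardF zq subrr rmorph_prod => E.
have : (\prod_(c : F) horner_mx (rG z) ('X - c%:P))%R \is a GRing.unit.
  elim/big_ind: _ => [|A B uA uB|c _]; first exact: unitr1.
    by rewrite unitrMl.
  rewrite rmorphB /= horner_mx_X horner_mx_C.
  exact: unit_sub.
by rewrite -E unitr0.
Qed.

(** By Cauchy and [torus_cent_prime], every prime divisor of the order divides q ^ 2 + 1, so the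
    order is coprime to the other factors of #|G|. *)
Lemma torus_cent_card y : torus_elt y -> (#|'C_G[y]| %| q ^ 2 + 1)%N.
Proof.
move=> Ty; have sCG : 'C_G[y] \subset G by apply: subsetIl.
have cop : coprime #|'C_G[y]| (q ^ 2 * (q - 1)).
  rewrite coprime_has_primes ?cardG_gt0 //; last first.
    by rewrite muln_gt0 !expn_gt0 subn_gt0 (ltn_trans _ q_gt7).
  apply/hasPn=> l; rewrite !mem_primes => /and3P[l_pr _ dv].
  rewrite l_pr cardG_gt0 /=; apply/negP=> /(Cauchy l_pr)[z Cz zl].
  have := torus_cent_prime Ty Cz; rewrite zl => /(_ l_pr)/and3P[_ _].
  rewrite zl => /(prime_dvd_q2D1 l_pr)[_ lq lq1 _].
  by move: dv; rewrite Euclid_dvdM // (negbTE lq1) Euclid_dvdX // (negbTE lq).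
by rewrite -(Gauss_dvdr _ cop) -cardG cardSg.
Qed.

(** A power w of z of prime order is again a torus element. Abelian centralisers then close the
    chain C(y) <= C(z) <= C(w) <= C(y). *)
Lemma torus_cent_eq y z :
  torus_elt y -> z \in 'C_G[y] -> z != 1 -> 'C_G[z] = 'C_G[y].
Proof.
move=> Ty Cz z1; have /setIP[Gz /cent1P cyz] := Cz.
have /and3P[Gy _ _] := Ty.
have ord1 : (1 < #[z])%N by rewrite order_gt1.
have [w zw ow] := Cauchy (pdiv_prime ord1) (pdiv_dvd #[z]).
have Cw : w \in 'C_G[y] by apply: subsetP zw; rewrite cycle_subG.
have Tw : torus_elt w by apply: torus_cent_prime Ty Cw _; rewrite ow pdiv_prime.
have sub u v : torus_elt u -> v \in 'C_G[u] -> 'C_G[u] \subset 'C_G[v].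
  move=> Tu Cv; apply/subsetP=> a Ca.
  rewrite inE (subsetP (subsetIl G 'C[u]) _ Ca); apply/cent1P.
  exact: (centsP (torus_cent_abelian Tu)).
apply/eqP; rewrite eqEsubset; apply/andP; split; last exact: sub.
apply: subset_trans (_ : 'C_G[w] \subset _); last first.
  apply: sub => //; rewrite inE Gy.
  by move/setIP: Cw => [_ /cent1P/commute_sym/cent1P].
apply/subsetP=> a /setIP[Ga /cent1P cza]; rewrite inE Ga; apply/cent1P.
by case/cycleP: zw => i ->; apply: commuteX.
Qed.

Lemma uniq_roots_in (R : unitRingType) (s : seq R) :
  uniq s -> {in s &, forall a b, a != b -> diff_roots a b} -> uniq_roots s.
Proof.
elim: s => //= a s IHs /andP[as_ us] ds; apply/andP; split; last first.
  by apply: IHs us _ => b c sb sc; apply: ds; rewrite inE ?sb ?sc orbT.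
apply/allP=> b sb; apply: ds; rewrite ?inE ?eqxx ?sb ?orbT //.
by apply: contraNneq as_ => ->.
Qed.

(* All conjugates of y satisfy the characteristic polynomial of y, and those
   commuting with y lie in the field F[y]. *)
Lemma torus_class_cent y : torus_elt y -> (#|y ^: G :&: 'C_G[y]| <= 4)%N.
Proof.
move=> Ty; have /and3P[Gy _ _] := Ty; set A := _ :&: _.
have AC a : a \in A -> a \in 'C_G[y] by case/setIP.
have AG a : a \in A -> a \in G by move/AC/setIP=> [].
pose cp := char_poly (rG y).
(* Over the noncommutative matrix ring, the degree bounds the number of roots as soon as these
   commute pairwise and have invertible differences. *)
have := @max_ring_poly_roots _ (map_poly (@scalar_mx F 4) cp)
  [seq rG a | a <- enum A].
rewrite size_map_poly size_char_poly size_map -cardE ltnS; apply.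
- by rewrite map_poly_eq0 -size_poly_eq0 size_char_poly.
- apply/allP=> _ /mapP[a Aa ->]; rewrite mem_enum in Aa.
  have /setIP[/imsetP[x Gx ->] _] := Aa.
  rewrite rootE -[X in X == _]/(horner_mx (rG (y ^ x)) cp).
  rewrite /conjg !repr_mxM ?groupM ?groupV // repr_mxV //.
  rewrite mulmxA horner_mx_uconjC ?repr_mx_unit //.
  by rewrite Cayley_Hamilton mulmx0 mul0mx.
- apply: uniq_roots_in => [|_ _ /mapP[a Aa ->] /mapP[b Ab ->] ab].
    rewrite map_inj_in_uniq ?enum_uniq // => a b.
    by rewrite !mem_enum => /AG Ga /AG Gb /(mx_faithful_inj faithG); apply.
  rewrite !mem_enum in Aa Ab; have Ga := AG a Aa; have Gb := AG b Ab.
  have cC c : c \in A -> rG c *m rG y = rG y *m rG c.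
    move=> Ac; apply/eqP; rewrite repr_comm ?(AG c Ac) //.
    by move/AC/setIP: Ac => [_ /cent1P ->].
  apply/andP; split.
    by apply/eqP; apply: (torus_comm_comm Ty); apply: cC.
  apply: (torus_comm_unit Ty); last by rewrite subr_eq0 eq_sym.
  by rewrite mulmxBl mulmxBr !cC.
Qed.

(** The size of the orbit divides the prime #[z], so a smaller orbit is a single point. *)
Lemma cent1_small_class (u z : gT) :
  prime #[z] -> (#|u ^: <[z]>| < #[z])%N -> z \in 'C[u].
Proof.
move=> z_pr; rewrite -index_cent1 => lt_z.
have := dvdn_indexg <[z]> 'C_(<[z]>)[u].
rewrite -orderE; case/primeP: z_pr => _ dv => /dv/orP[/eqP i1 | /eqP iz].
  have sub := index1g (subsetIl _ _) i1.
  by move: (cycle_id z); rewrite -{1}sub => /setIP[].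
by rewrite iz ltnn in lt_z.
Qed.

(** The conjugates of y under the powers of z lie in C(y), which contains at most 4 of them: too few
    for an orbit of length #[z]. *)
Lemma torus_norm y z : torus_elt y -> z \in 'N_G('C_G[y]) ->
  prime #[z] -> (4 < #[z])%N -> z \in 'C_G[y].
Proof.
move=> Ty /setIP[Gz Nz] z_pr z_gt4; have /and3P[Gy _ _] := Ty.
rewrite inE Gz cent1_small_class // (leq_trans _ z_gt4) // ltnS.
apply: leq_trans (torus_class_cent Ty); apply: subset_leq_card.
apply/subsetP=> _ /imsetP[w zw ->].
have Gw : w \in G by apply: subsetP zw; rewrite cycle_subG.
have Nw : w \in 'N('C_G[y]) by apply: subsetP zw; rewrite cycle_subG.
by rewrite inE memJ_class //= memJ_norm // inE Gy cent1id.
Qed.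

(** * Solvable subgroups containing a torus element, and the orders of tori *)

Variable H : {group gT}.
Hypotheses (sHG : H \subset G) (cardH : #|H| = (q - 1)%N).
Hypothesis classH : forall n, n \in G -> (#|n ^: G :&: H| <= 4)%N.

(** A minimal normal subgroup [N] of <x, y> is an elementary abelian s-group. Only primes s dividing
    q ^ 2 + 1 survive, and then C(y) = C(N), which <x, y> normalises. *)
Lemma torus_sol y x : torus_elt y -> x \in G ->
  solvable <<[set x; y]>> -> x \in 'N_G('C_G[y]).
Proof.
move=> Ty Gx; have /and3P[Gy l_pr l_dv] := Ty.
have [l_gt4 _ _ _] := prime_dvd_q2D1 l_pr l_dv.
pose K := <<[set x; y]>>%G; move=> solK.
have sKG : K \subset G by rewrite gen_subG; apply/subsetP=> z /set2P[]->.
have Kx : x \in K by rewrite mem_gen ?set21.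
have Ky : y \in K by rewrite mem_gen ?set22.
have y1 : y != 1 by apply: contraTneq l_pr => ->; rewrite order1.
have ntK : K :!=: 1 by apply/trivgPn; exists y.
have [N minN sNK] := minnormal_exists ntK (normG K).
have [nNK ntN abN] := minnormal_solvable minN sNK solK.
have [s s_pr abelN] := is_abelemP abN.
have [n Nn n1] := trivgPn _ ntN.
have on : #[n] = s by apply: abelem_order_p abelN Nn n1.
have sN : s.-group N := abelem_pgroup abelN.
have sNG := subset_trans sNK sKG; have Gn := subsetP sNG n Nn.
have classN : n ^: <[y]> \subset n ^: G :&: N.
  apply/subsetP=> _ /imsetP[w yw ->]; rewrite inE memJ_class; last first.
    by apply: subsetP yw; rewrite cycle_subG.
  rewrite memJ_norm //; apply: subsetP yw.
  by rewrite cycle_subG (subsetP nNK).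
have cent_yn : (#|n ^: <[y]>| <= 4)%N -> n \in 'C_G[y].
  move=> le4; rewrite inE Gn cent1C cent1_small_class //.
  exact: leq_ltn_trans le4 _.
have : (s %| #|G|)%N by rewrite -on order_dvdG.
rewrite cardG Euclid_dvdM // Euclid_dvdM // => /orP[/orP[] | ] s_dv.
(* A 2-group in characteristic 2 fixes a nonzero vector. The fixed space of [N] is stable under y,
   hence everything, against faithfulness. *)
- have s2 : s = 2%N.
    move: s_dv; rewrite -expnM Euclid_dvdX // => /andP[+ _].
    by rewrite dvdn_prime2 // => /eqP.
  rewrite s2 in sN.
  have c2 : 2 \in [pchar F] := card_finPcharP cardF (isT : prime 2).
  have U0 := rfix_pgroup_pchar c2 rG (isT : 0 < 4)%N sN sNG.
  have : (rfix_mx rG N *m rG y <= rfix_mx rG N)%MS.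
    have Ny : y \in 'N(N) by apply: subsetP nNK _ Ky.
    by rewrite -(rfix_mx_conjsg rG Gy sNG) (normP Ny).
  case/(torus_stable_rank Ty)/orP; first by rewrite mxrank_eq0 (negbTE U0).
  move=> fullU; have /rfix_mxP fixN : (1%:M <= rfix_mx rG N)%MS by rewrite sub1mx.
  have : n \in rker rG by apply/rkerP; split; rewrite // -[RHS](fixN n Nn) mul1mx.
  by rewrite (trivgP faithG) inE (negbTE n1).
(* Here s divides q - 1, so [H] contains a Sylow s-subgroup of [G] and [N] is conjugate into [H].
   Then n has at most 4 conjugates in [N], y centralises n, and s would divide q ^ 2 + 1 as well. *)
- have [P sylP] := Sylow_exists s H.
  have sylPG : s.-Sylow(G) P.
    rewrite pHallE (subset_trans (pHall_sub sylP)) //= (card_Hall sylP) cardH.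
    have cop m : (0 < m)%N -> ~~ (s %| m)%N -> (m`_s = 1)%N.
      move=> m0 sm; apply: part_p'nat; rewrite p'natE //.
    have [q0 q1] : (0 < q ^ 2)%N /\ (0 < q - 1)%N.
      by rewrite !expn_gt0 subn_gt0 (ltn_trans _ q_gt7).
    have s_q : ~~ (s %| q)%N.
      apply/negP=> sq; have := dvdn_sub sq s_dv.
      rewrite subKn; last by rewrite (leq_trans _ (ltnW q_gt7)).
      by rewrite dvdn1; move: s_pr; case: (s) => [|[]].
    rewrite cardG partnM ?muln_gt0 ?expn_gt0 ?q1 ?addn1 //.
    rewrite (partnM _ q0 q1).
    rewrite (cop (q ^ 2)%N) //; last by rewrite Euclid_dvdX // (negbTE s_q).
    rewrite (cop (q ^ 2).+1) ?muln1 ?mul1n //; apply: contraL s_dv.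
    by rewrite -[(q ^ 2).+1]addn1 => s_dv; have [] := prime_dvd_q2D1 s_pr s_dv.
  have [g Gg sNP] := Sylow_Jsub sylPG sNG sN.
  suff /cent_yn Cyn : (#|n ^: <[y]>| <= 4)%N.
    have := torus_cent_prime Ty Cyn; rewrite on => /(_ s_pr)/and3P[_ _].
    by rewrite on => s_dv'; have [_ _ /negP] := prime_dvd_q2D1 s_pr s_dv'.
  apply: leq_trans (classH Gn); apply: leq_trans (subset_leq_card classN) _.
  rewrite -(cardJg _ g) conjIg; apply: subset_leq_card; apply: setISS.
    by rewrite (normP _) // (subsetP (class_norm _ _)).
  exact: subset_trans sNP (pHall_sub sylP).
(* In the last case n is a torus element and [N] lies in the abelian group C(n), so again n has at
   most 4 conjugates in [N] and commutes with y. *)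
have Tn : torus_elt n by rewrite /torus_elt Gn on s_pr.
have sNC : N \subset 'C_G[n].
  by rewrite subsetI sNG sub_cent1 (subsetP (abelem_abelian abelN)).
have Cyn : n \in 'C_G[y].
  apply: cent_yn; apply: leq_trans (torus_class_cent Tn).
  by rewrite subset_leq_card // (subset_trans classN) // setIS.
have <- : 'C_G(N) = 'C_G[y].
  rewrite -(torus_cent_eq Ty Cyn n1); apply/eqP; rewrite eqEsubset.
  rewrite setIS /=; last by rewrite -cent_set1 centS // sub1set.
  rewrite subsetI subsetIl centsC (subset_trans sNC) //.
  exact: torus_cent_abelian Tn.
have nK : K \subset 'N('C_G(N)).
  by rewrite normsI ?norms_cent // (subset_trans sKG (normG G)).
by rewrite inE Gx (subsetP nK).
Qed.

(* An involution normalising the odd abelian group C(y) without centralising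
   anything in it inverts it, so two such involutions agree modulo C(y). *)
Lemma torus_norm_involutions y : torus_elt y ->
  (#|[set i in 'N_G('C_G[y]) | #[i] == 2%N]| <= #|'C_G[y]|)%N.
Proof.
move=> Ty; set C := 'C_G[y]; set I := [set i in _ | _].
have CC a b : a \in C -> b \in C -> a * b = b * a.
  by move=> Ca Cb; apply: (centsP (torus_cent_abelian Ty)).
have oddC : odd #|C|.
  by apply: dvdn_odd (torus_cent_card Ty) _; rewrite oddD oddX (negbTE q_even).
have invC i c : i \in I -> c \in C -> c ^ i = c^-1.
  rewrite inE => /andP[/setIP[Gi Ni] /eqP oi] Cc.
  have Cci : c ^ i \in C by rewrite memJ_norm.
  have ii : i * i = 1 by rewrite -(expg_order i) oi.
  (* The product of c and its conjugate is fixed by i. Were it nontrivial, its centraliser C(y), of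
     odd order, would contain the involution i. *)
  apply/eqP; rewrite eq_sym eq_invg_mul; apply/negPn/negP=> nt.
  have Cd : c * c ^ i \in C by rewrite groupM.
  have : i \in C.
    rewrite /C -(torus_cent_eq Ty Cd nt) inE Gi; apply/cent1P.
    by rewrite /commute [RHS]conjgC conjMg -conjgM ii conjg1 (CC _ _ Cci Cc).
  move/order_dvdG; rewrite oi dvdn2 oddC //.
have [-> | [i0 Ii0]] := set_0Vmem I; first by rewrite cards0.
rewrite -(card_imset _ (mulIg i0)); apply: subset_leq_card.
apply/subsetP=> _ /imsetP[i Ii ->].
have [/andP[/setIP[Gi Ni] _] /andP[/setIP[Gi0 Ni0] _]] : 
  (i \in 'N_G(C)) && (#[i] == 2%N) /\ (i0 \in 'N_G(C)) && (#[i0] == 2%N).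
  by move: Ii Ii0; rewrite !inE.
have Cy : y \in C by case/and3P: Ty => Gy _ _; rewrite inE Gy cent1id.
rewrite inE groupM //; apply/cent1P; rewrite /commute [RHS]conjgC.
by rewrite conjgM (invC i) // conjVg (invC i0) // invgK.
Qed.

(** Let u in C(y) have order l, [Q] be a Sylow subgroup containing u, and z != 1 be central in [Q].
    Then z lies in C(u) = C(y), and [Q] lies in C(z) = C(y). *)
Lemma torus_cent_Hall y l : torus_elt y -> prime l -> (l %| #|'C_G[y]|)%N ->
  exists2 Q : {group gT}, l.-Sylow(G) Q & Q \subset 'C_G[y].
Proof.
move=> Ty l_pr /(Cauchy l_pr)[u Cu ou].
have u1 : u != 1 by apply: contraTneq l_pr => u1; rewrite -ou u1 order1.
have Gu : u \in G by case/setIP: Cu.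
have lu : l.-group <[u]> by rewrite /pgroup -orderE ou pnat_id.
have suG : <[u]> \subset G by rewrite cycle_subG.
have [Q sylQ suQ] := Sylow_superset suG lu.
exists Q => //; have Qu : u \in Q by rewrite -cycle_subG.
have [z Zz z1] : exists2 z, z \in 'Z(Q) & z != 1.
  apply/trivgPn; apply: contraNneq u1 => ZQ1; move: Qu.
  by rewrite (trivg_center_pgroup (pHall_pgroup sylQ) ZQ1) => /set1P->.
have /setIP[Qz cQz] := Zz; have Gz := subsetP (pHall_sub sylQ) z Qz.
have Cz : z \in 'C_G[y].
  rewrite -(torus_cent_eq Ty Cu u1) inE Gz.
  by apply/cent1P/(centP cQz).
rewrite -(torus_cent_eq Ty Cz z1) subsetI (pHall_sub sylQ) /=.
by rewrite sub_cent1.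
Qed.

Lemma torus_cent_conj y g : y \in G -> g \in G -> 'C_G[y ^ g] = 'C_G[y] :^ g.
Proof. by move=> Gy Gg; rewrite conjIg conjGid // -normJ conjg_set1. Qed.

Lemma torus_eltJ y g : g \in G -> torus_elt (y ^ g) = torus_elt y.
Proof. by move=> Gg; rewrite /torus_elt orderJ groupJr. Qed.

(** The index is the number of conjugates of y under the normaliser, and these all lie in C(y). *)
Lemma torus_index_norm y : torus_elt y ->
  (#|'N_G('C_G[y]) : 'C_G[y]| <= 4)%N.
Proof.
move=> Ty; have /and3P[Gy _ _] := Ty.
apply: leq_trans (torus_class_cent Ty).
have sCN : 'C_G[y] \subset 'N_G('C_G[y]) by rewrite subsetI subsetIl normG.
have -> : #|'N_G('C_G[y]) : 'C_G[y]| = #|y ^: 'N_G('C_G[y])|.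
  rewrite -index_cent1; congr #|_ : _|.
  by apply/eqP; rewrite eqEsubset subsetI sCN subsetIr setSI ?subsetIl.
apply: subset_leq_card; apply/subsetP=> _ /imsetP[w /setIP[Gw Nw] ->].
by rewrite inE memJ_class //= memJ_norm // inE Gy cent1id.
Qed.

(** Otherwise the number m of conjugates of C(y) is 1 modulo q ^ 2 + 1, while m n = q ^ 2 (q - 1),
    where n <= 4 is the index of C(y) in its normaliser. *)
Lemma torus_cent_neq y : torus_elt y -> #|'C_G[y]| != (q ^ 2 + 1)%N.
Proof.
move=> Ty; have /and3P[Gy _ _] := Ty; set C := 'C_G[y]; apply/eqP=> cC.
have sCG : C \subset G by apply: subsetIl.
have sCN : C \subset 'N_G(C) by rewrite subsetI sCG normG.
have dv : (#|C| %| #|G : 'N_G(C)| - 1)%N.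
  (* A nontrivial element of [C] normalising the conjugate has a power v of prime order above 4. By
     [torus_norm] v lies in both tori, so both equal C(v). *)
  apply: index_norm_TI => // g Gg CgC.
  apply/trivgP/subsetP=> w /setIP[Cw Nw]; apply/set1P/eqP/negPn/negP=> w1.
  have ord1 : (1 < #[w])%N by rewrite order_gt1.
  have [v wv ov] := Cauchy (pdiv_prime ord1) (pdiv_dvd #[w]).
  have Cv : v \in C by apply: subsetP wv; rewrite cycle_subG.
  have v_pr : prime #[v] by rewrite ov pdiv_prime.
  have v1 : v != 1 by apply: contraTneq v_pr => ->; rewrite order1.
  have Tv := torus_cent_prime Ty Cv v_pr.
  have /and3P[Gv _ v_dv] := Tv; have [v_gt4 _ _ _] := prime_dvd_q2D1 v_pr v_dv.
  have Tyg : torus_elt (y ^ g) by rewrite torus_eltJ.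
  have Cgv : v \in 'C_G[y ^ g].
    apply: torus_norm => //; rewrite inE Gv torus_cent_conj //.
    by apply: subsetP wv; rewrite cycle_subG.
  case/eqP: CgC; rewrite -torus_cent_conj // -(torus_cent_eq Tyg Cgv v1).
  exact: torus_cent_eq.
have n_le4 := torus_index_norm Ty; rewrite -/C in n_le4.
have n_gt0 : (0 < #|'N_G(C) : C|)%N by apply: indexg_gt0.
have m_gt0 : (0 < #|G : 'N_G(C)|)%N by apply: indexg_gt0.
have q7 := q_gt7; have q2 : (0 < q ^ 2 + 1)%N by rewrite addn1.
have idx : (#|G : 'N_G(C)| * #|'N_G(C) : C| = q ^ 2 * (q - 1))%N.
  apply/eqP; rewrite -(eqn_pmul2l q2) -cC mulnC Lagrange_index ?subsetIl //.
  by rewrite mulnC Lagrange // cardG cC mulnC.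
have dv1 : (q ^ 2 + 1 %| q ^ 2 * (q - 1) - #|'N_G(C) : C|)%N.
  by rewrite -idx -{2}[#|'N_G(C) : C|]mul1n -mulnBl -cC dvdn_mulr.
(* Subtracting from (q ^ 2 + 1) (q - 1) leaves q - 1 + n, which is positive and too small to be a
   multiple of q ^ 2 + 1. *)
have dv2 := dvdn_sub (dvdn_mulr (q - 1) (dvdnn (q ^ 2 + 1)%N)) dv1.
have n_le : (#|'N_G(C) : C| <= q ^ 2 * (q - 1))%N by rewrite -idx leq_pmull.
rewrite mulnDl mul1n subnBA // -addnA addKn in dv2.
have := dvdn_leq _ dv2; rewrite addn_gt0 n_gt0 orbT => /(_ isT).
by rewrite -mulnn; move: (#|'N_G(C) : C|) n_le4 (q) q7; clear; nia.
Qed.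

Lemma exists_torus_elt l : prime l -> (l %| q ^ 2 + 1)%N ->
  exists2 y, torus_elt y & #[y] = l.
Proof.
move=> l_pr l_dv; have : (l %| #|G|)%N by rewrite cardG dvdn_mull.
case/(Cauchy l_pr)=> y Gy oy; exists y => //.
by rewrite /torus_elt Gy oy l_pr.
Qed.

(** For a common prime l both centralisers contain Sylow l-subgroups of [G]. Conjugating one onto
    the other makes the two tori share a nontrivial element, so they are conjugate and have equal
    orders. *)
Lemma torus_cent_coprime y1 y2 : torus_elt y1 -> torus_elt y2 ->
  #|'C_G[y1]| != #|'C_G[y2]| -> coprime #|'C_G[y1]| #|'C_G[y2]|.
Proof.
move=> T1 T2; apply: contraR; rewrite coprime_has_primes ?cardG_gt0 // negbK.
case/hasP=> l; rewrite !mem_primes => /and3P[l_pr _ dv2] /and3P[_ _ dv1].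
have [Q1 sylQ1 sQ1] := torus_cent_Hall T1 l_pr dv1.
have [Q2 sylQ2 sQ2] := torus_cent_Hall T2 l_pr dv2.
have [g Gg Q2E] := Sylow_trans sylQ1 sylQ2.
have l_dvQ : (l %| #|Q1|)%N.
  rewrite (card_Hall sylQ1) p_part dvdn_exp // logn_gt0 mem_primes l_pr.
  by rewrite cardG_gt0 (dvdn_trans dv1) // cardSg ?subsetIl.
have [u Qu ou] := Cauchy l_pr l_dvQ.
have u1 : u != 1 by apply: contraTneq l_pr => u1; rewrite -ou u1 order1.
have Qug : u ^ g \in Q2 by rewrite Q2E memJ_conjg.
have Gu := subsetP (pHall_sub sylQ1) u Qu.
rewrite -(torus_cent_eq T1 (subsetP sQ1 u Qu) u1).
rewrite -(torus_cent_eq T2 (subsetP sQ2 _ Qug)) ?conjg_eq1 //.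
by rewrite torus_cent_conj // cardJg.
Qed.

(* Were all the orders of tori larger than q, two different ones would be
   coprime divisors of q^2 + 1, so there would be a single one, q^2 + 1. *)
Lemma exists_small_torus : exists2 y, torus_elt y & (#|'C_G[y]| <= q - 1)%N.
Proof.
have q7 := q_gt7.
have q2_gt1 : (1 < q ^ 2 + 1)%N by rewrite addn1 ltnS !expn_gt0.
have [y1 T1 _] := exists_torus_elt (pdiv_prime q2_gt1) (pdiv_dvd _).
have [le1 | gt1] := leqP #|'C_G[y1]| (q - 1); first by exists y1.
have [d dE] := dvdnP (torus_cent_card T1).
have d_gt1 : (1 < d)%N.
  case: d dE => [|[|d]] // dE; first by rewrite dE in q2_gt1.
  by case/eqP: (torus_cent_neq T1); rewrite dE mul1n.
have l_pr := pdiv_prime d_gt1; set l := pdiv d in l_pr.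
have l_dvd : (l %| d)%N := pdiv_dvd d.
have l_dv : (l %| q ^ 2 + 1)%N by rewrite dE dvdn_mulr.
have [y2 T2 o2] := exists_torus_elt l_pr l_dv.
have /and3P[Gy2 _ _] := T2.
have l_dv2 : (l %| #|'C_G[y2]|)%N by rewrite -o2 order_dvdG // inE Gy2 cent1id.
(* l divides the cofactor of #|C(y1)| in q ^ 2 + 1. If it also divided #|C(y1)|, a full Sylow
   l-subgroup would lie in C(y1), leaving one factor l too many in #|G|. *)
have neq : #|'C_G[y1]| != #|'C_G[y2]|.
  apply/eqP=> E; rewrite -E in l_dv2.
  have [Q sylQ sQ] := torus_cent_Hall T1 l_pr l_dv2.
  have : (l * #|Q| %| #|G|)%N.
    by rewrite cardG dE dvdn_mull // dvdn_mul // cardSg.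
  by rewrite (card_Hall sylQ) p_part -expnS pfactor_dvdn // ltnn.
have cop := torus_cent_coprime T1 T2 neq.
have := dvdn_leq _ (_ : (#|'C_G[y1]| * #|'C_G[y2]| %| q ^ 2 + 1)%N).
rewrite Gauss_dvd // !torus_cent_card // ltnW // => /(_ isT isT) le12.
exists y2 => //; rewrite leqNgt; apply/negP=> gt2.
(* Since q does not divide q ^ 2 + 1, the first order is at least q + 1. With the second at least q,
   the product exceeds q ^ 2 + 1. *)
have nq1 : #|'C_G[y1]| != q.
  apply: contraTneq (torus_cent_card T1) => ->.
  by rewrite dvdn_addr ?dvdn1 -?mulnn ?dvdn_mulr //; lia.
move: le12; rewrite -mulnn.
by move: #|'C_G[y1]| #|'C_G[y2]| (q) gt1 gt2 nq1 q7; clear; nia.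
Qed.

(** * Counting the conjugates of y that generate a solvable group with x *)

Hypothesis cent_invol :
  forall x, x \in G -> #[x] = 2%N -> (#|'C_G[x]| <= q ^ 2)%N.

Local Notation sol_class x y := [set z in y ^: G | solvable <<[set x; z]>>].

(** The order of [G] is prime to 3, because q is 2 modulo 3. Thus every odd prime involved is large
    enough for [torus_norm]. *)
Lemma prime_dvd_card l : prime l -> (l %| #|G|)%N -> (l == 2) || (4 < l)%N.
Proof.
move=> l_pr l_dv; have l_gt1 := prime_gt1 l_pr.
have l3 : l != 3.
  apply: contraTneq l_dv => ->; have q3 := q_mod3.
  rewrite cardG Euclid_dvdM // Euclid_dvdM //; apply/negP=> /orP[/orP[] | ] dv.
  - by move: dv; rewrite Euclid_dvdX // /dvdn q3.
  - have q_gt0 : (0 < q)%N by rewrite expn_gt0.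
    by move/dvdnP: dv q3 q_gt0 => [m]; move: (q) => Q; clear; lia.
  - by have [] := prime_dvd_q2D1 (isT : prime 3) dv.
have l4 : l != 4 by apply: contraTneq l_pr => ->.
by case: (l) l_gt1 l3 l4 => [|[|[|[|[|]]]]].
Qed.

Lemma sol_genJ (x z g : gT) :
  solvable <<[set x ^ g; z ^ g]>> = solvable <<[set x; z]>>.
Proof.
have -> : [set x ^ g; z ^ g] = [set x; z] :^ g by rewrite conjUg !conjg_set1.
by rewrite genJ -(isog_sol (conj_isog <<[set x; z]>>%G g)).
Qed.

(** Both sides count the pairs in the product of the two classes that generate a solvable group;
    conjugation makes the inner sums constant. *)
Lemma sol_class_double_count x y : x \in G -> y \in G ->
  (#|x ^: G| * #|sol_class x y| =
     #|y ^: G| * #|[set z in x ^: G | solvable <<[set z; y]>>]|)%N.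
Proof.
move=> Gx Gy.
have E1 : (\sum_(w in x ^: G) \sum_(z in y ^: G | solvable <<[set w; z]>>) 1 =
    #|x ^: G| * #|sol_class x y|)%N.
  rewrite -sum_nat_const; apply: eq_bigr => _ /imsetP[g Gg ->].
  rewrite sum1dep_card -[RHS](cardJg _ g); apply: eq_card => z.
  rewrite mem_conjg !inE memJ_norm; last first.
    by rewrite (subsetP (class_norm _ _)) // groupV.
  by congr (_ && _); rewrite -[RHS](sol_genJ _ _ g) conjgKV.
have E2 : (\sum_(z in y ^: G) \sum_(w in x ^: G | solvable <<[set w; z]>>) 1 =
    #|y ^: G| * #|[set z in x ^: G | solvable <<[set z; y]>>]|)%N.
  rewrite -sum_nat_const; apply: eq_bigr => _ /imsetP[g Gg ->].
  rewrite sum1dep_card -[RHS](cardJg _ g); apply: eq_card => z.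
  rewrite mem_conjg !inE memJ_norm; last first.
    by rewrite (subsetP (class_norm _ _)) // groupV.
  by congr (_ && _); rewrite -[RHS](sol_genJ _ _ g) conjgKV.
rewrite -E1 -E2 (exchange_big_dep (mem (y ^: G))) /=; last first.
  by move=> w z _ /andP[].
by apply: eq_bigr => z yz; apply: eq_bigl => w; rewrite yz.
Qed.

Lemma sol_class_prime_bound y w : torus_elt y -> (#|'C_G[y]| <= q - 1)%N ->
  w \in G -> prime #[w] -> (#|sol_class w y| <= q ^ 2)%N.
Proof.
move=> Ty le_C Gw w_pr; have /and3P[Gy _ _] := Ty; have q7 := q_gt7.
have TyG z : z \in y ^: G -> torus_elt z.
  by case/imsetP=> g Gg ->; rewrite torus_eltJ.
(* If w is an involution, those of its conjugates that are solvable with y are involutions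
   normalising C(y), at most #|C(y)| of them. The double count then bounds the set by #|C(w)| <= q ^
   2. *)
have /orP[/eqP w2 | w4] := prime_dvd_card w_pr (order_dvdG Gw).
  have := sol_class_double_count Gw Gy; rewrite -!index_cent1 => E.
  have cw0 := cardG_gt0 'C_G[w]; have cy0 := cardG_gt0 'C_G[y].
  have Ew := Lagrange (subsetIl G 'C[w]).
  have Ey := Lagrange (subsetIl G 'C[y]).
  have le_I : (#|[set z in w ^: G | solvable <<[set z; y]>>]| <= #|'C_G[y]|)%N.
    apply: leq_trans (torus_norm_involutions Ty); apply: subset_leq_card.
    apply/subsetP=> z; rewrite !inE => /andP[/imsetP[g Gg ->] solz].
    have := torus_sol Ty (groupJ Gw Gg) solz.
    by rewrite !inE orderJ w2 eqxx andbT.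
  have cw := cent_invol Gw w2.
  have G0 := cardG_gt0 G.
  rewrite -(leq_pmul2l G0) -{1}Ew -mulnA E.
  apply: leq_trans (leq_mul cw (leq_mul (leqnn _) le_I)) _.
  by rewrite [(#|G : _| * _)%N]mulnC Ey mulnC.
(* If #[w] > 4, then w lies in C(z) for each z in the set, so the whole set lies in C(w) = C(z0),
   which has at most q - 1 elements. *)
have [-> | [z0 Zz0]] := set_0Vmem (sol_class w y); first by rewrite cards0.
have cent_wz z : z \in sol_class w y -> torus_elt z /\ w \in 'C_G[z].
  rewrite inE => /andP[yz solz]; split; first exact: TyG.
  by apply: torus_norm => //; [apply: TyG | apply: torus_sol => //; apply: TyG].
have [T0 Cw0] := cent_wz z0 Zz0.
have w1 : w != 1 by apply: contraTneq w_pr => ->; rewrite order1.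
have sub : sol_class w y \subset 'C_G[z0].
  apply/subsetP=> z Zz; have [Tz Cwz] := cent_wz z Zz.
  rewrite -(torus_cent_eq T0 Cw0 w1) inE; have /and3P[-> _ _] := Tz.
  by rewrite cent1C; case/setIP: Cwz.
apply: leq_trans (subset_leq_card sub) _.
have /imsetP[g Gg ->] : z0 \in y ^: G by move: Zz0; rewrite inE => /andP[].
rewrite torus_cent_conj // cardJg (leq_trans le_C) //.
by rewrite (leq_trans (leq_subr 1 q)) // -mulnn leq_pmulr // expn_gt0.
Qed.

(** Replacing x by a power of prime order can only enlarge the set, since subgroups of solvable
    groups are solvable. *)
Lemma sol_class_bound y x : torus_elt y -> (#|'C_G[y]| <= q - 1)%N ->
  x \in G -> x != 1 -> (#|sol_class x y| <= q ^ 2)%N.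
Proof.
move=> Ty le_C Gx x1.
have ord1 : (1 < #[x])%N by rewrite order_gt1.
have [w wx ow] := Cauchy (pdiv_prime ord1) (pdiv_dvd #[x]).
have Gw : w \in G by apply: subsetP wx; rewrite cycle_subG.
apply: leq_trans (sol_class_prime_bound Ty le_C Gw _); last first.
  by rewrite ow pdiv_prime.
apply: subset_leq_card; apply/subsetP=> z; rewrite !inE => /andP[-> /=].
apply: solvableS; rewrite gen_subG; apply/subsetP=> u /set2P[]->.
  by apply: subsetP wx; rewrite cycle_subG mem_gen ?set21.
by rewrite mem_gen ?set22.
Qed.

Lemma sol_covering_card (X : {set gT}) : X \subset G -> 1 \notin X ->
  {in G, forall g, exists2 x, x \in X & solvable <<[set x; g]>>} ->
  (q ^ 2 + 1 <= #|X|)%N.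
Proof.
move=> sXG X1 covX; have [y Ty le_C] := exists_small_torus.
have /and3P[Gy _ _] := Ty.
have q7 := q_gt7.
have leY : (#|y ^: G| <= #|X| * q ^ 2)%N.
  have sY : y ^: G \subset \bigcup_(x in X) sol_class x y.
    apply/subsetP=> z yz; have Gz : z \in G.
      by apply: subsetP yz; rewrite class_subG.
    by have [x Xx solx] := covX z Gz; apply/bigcupP; exists x; rewrite // inE yz.
  apply: leq_trans (subset_leq_card sY) _.
  apply: (@leq_trans (\sum_(x in X) #|sol_class x y|)).
    elim/big_rec2: _ => [|x m A _ le_A]; first by rewrite cards0.
    by apply: leq_trans (leq_card_setU _ _) _; rewrite leq_add2l.
  rewrite -sum_nat_const; apply: leq_sum => x Xx; apply: sol_class_bound => //.
    exact: subsetP Xx.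
  by apply: contraNneq X1 => <-.
have Ey := Lagrange (subsetIl G 'C[y]).
rewrite -index_cent1 in leY.
have : (q ^ 2 * (q - 1) * (q ^ 2 + 1) <= q ^ 2 * (q - 1) * #|X|)%N.
  rewrite -cardG -Ey mulnC.
  apply: leq_trans (leq_mul leY le_C) _.
  by rewrite -mulnA mulnC.
by rewrite leq_pmul2l // muln_gt0 !expn_gt0 subn_gt0 (ltn_trans _ q7).
Qed.

End Torus.

End Tori.

Import Tori.

(** * Application to the Suzuki group and transport along the isomorphism *)

Module SuzukiTori.

Set Implicit Arguments.
Unset Strict Implicit.
Unset Printing Implicit Defensive.

Import GRing.Theory.
Local Open Scope ring_scope.
Import GroupScope.

Section SuzukiGlue.

Variables (p : nat) (F : finFieldType).
Hypotheses (p_odd : odd p) (cardF : #|F| = (2 ^ p)%N).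

Local Notation q := (2 ^ p)%N.
Local Notation GL4 := (GL4 F).
Local Notation suz := (suz_group F).

Lemma suz_mx_repr : mx_repr suz (@GLmx F).
Proof. by split=> // x y _ _; apply: GLmxM. Qed.

Definition suz_repr := MxRepresentation suz_mx_repr.

Lemma suz_repr_faithful : mx_faithful suz_repr.
Proof.
apply/subsetP=> x /rkerP[_ x1]; apply/set1P; apply: (@GLmx_inj F).
exact: x1.
Qed.

Canonical suz_Q_group := Group (suz_Q_group_set p_odd cardF).
Canonical suz_H_group := Group (suz_H_group_set p_odd cardF).

Lemma suz_Q_Sylow : 2.-Sylow(suz) (suz_Q F).
Proof.
have q_gt0 : (0 < q)%N by rewrite expn_gt0.
have p_gt0 : (0 < p)%N by case: p p_odd.
have odd_n : odd ((q - 1) * (q ^ 2 + 1)).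
  by rewrite oddM oddB // oddD !oddX /= !eqn0Ngt p_gt0.
rewrite pHallE suz_Q_sub /= (card_suz_Q cardF) (card_Sz p_odd cardF) -mulnA.
rewrite (partnM _ _ (odd_gt0 odd_n)) ?expn_gt0 //.
have q2 : (2.-nat (q ^ 2))%N by rewrite !pnatX pnat_id // !orbT.
rewrite (part_pnat_id q2).
rewrite part_p'nat ?muln1 //.
by rewrite p'natE // dvdn2 odd_n.
Qed.

(** By Sylow, x may be taken in [suz_Q]. The square of [szS a b] is [szS 0 (theta a * a)], so an
    involution has a = 0 and [cent_szS0] applies. *)
Lemma suz_cent_involution x :
  x \in suz -> #[x] = 2%N -> (#|'C_suz[x]| <= q ^ 2)%N.
Proof.
move=> Gx ox.
have px : 2.-group <[x]> by rewrite /pgroup -orderE ox.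
have sxG : <[x]> \subset suz by rewrite cycle_subG.
have [g Gg sxQ] := Sylow_Jsub suz_Q_Sylow sxG px.
have /imsetP[[a b] _ xgE] : x ^ g \in suz_Q F.
  by rewrite (subsetP sxQ) // memJ_conjg cycle_id.
have xx : x ^ g * x ^ g = 1.
  by rewrite -conjMg -[x * x]/(x ^+ 2)%g -ox expg_order conj1g.
rewrite /= in xgE.
have c2 := suz_pchar2 cardF.
have a0 : a = 0.
  move: xx; rewrite xgE (szS_mul p_odd cardF) -(szS0 F) => /szS_inj[_] /eqP.
  by rewrite (addrr_pchar2 c2) add0r mulf_eq0 theta_eq0 orbb => /eqP.
have b0 : b != 0.
  apply/eqP=> b0; move: ox; have -> : x = 1; last by rewrite order1.
  by apply/eqP; rewrite -(conjg_eq1 x g) xgE a0 b0 szS0.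
rewrite -(cardJg _ g) conjIg conjGid // -normJ conjg_set1 xgE a0.
rewrite -(card_suz_Q cardF); apply: subset_leq_card.
exact: (cent_szS0 p_odd cardF b0).
Qed.

(** An element of [suz_H] is determined by its second diagonal entry. For a conjugate of n this
    entry is an eigenvalue of n, a root of a polynomial of degree 4. *)
Lemma suz_H_class n :
  n \in suz -> (#|n ^: suz :&: suz_H F| <= 4)%N.
Proof.
move=> Gn; set A := _ :&: _.
pose i1 := Ordinal (isT : (1 < 4)%N).
pose ev (h : GL4) := GLmx h i1 i1.
pose cp := char_poly (GLmx n).
have AH h : h \in A -> exists2 z, z != 0 & h = szM z.
  by case/setIP=> _ /imsetP[z]; rewrite !inE => z0 ->; exists z.
have := @max_poly_roots _ cp [seq ev h | h <- enum A].
rewrite size_char_poly size_map -cardE ltnS; apply.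
- by rewrite -size_poly_eq0 size_char_poly.
- apply/allP=> _ /mapP[h Ah ->]; rewrite mem_enum in Ah.
  rewrite -eigenvalue_root_char; have [z z0 hE] := AH h Ah.
  have /setIP[/imsetP[x Gx hx] _] := Ah.
  apply/eigenvalueP.
  have xV : GLmx x *m GLmx x^-1 = 1%:M by rewrite -GLmxM mulgV GLmx1.
  have dH : (delta_mx 0 i1 *m GLmx h = ev h *: (delta_mx 0 i1 : 'rV_4))%R.
    rewrite /ev hE (val_szM p_odd cardF) //; apply/rowP=> j.
    rewrite -rowE !mxE.
    by case: j => [[|[|[|[|j]]]] hj] //=; rewrite ?mulr0 ?mulr1.
  (* Since h is the conjugate of n by x, the row eigenvector of h moves to one of n through the
     inverse of x. *)
  exists (delta_mx 0 i1 *m GLmx x^-1); last first.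
    apply/eqP=> /(congr1 (mulmx^~ (GLmx x))).
    rewrite mul0mx -mulmxA -GLmxM mulVg GLmx1 mulmx1 => /rowP/(_ i1)/eqP.
    by rewrite !mxE !eqxx oner_eq0.
  rewrite scalemxAl -dH hx /conjg !GLmxM -!mulmxA xV mulmx1.
  by [].
rewrite map_inj_in_uniq ?enum_uniq // => h h'; rewrite !mem_enum.
case/AH=> z z0 -> /AH[w w0 ->].
by rewrite /ev !(val_szM p_odd cardF) // !mxE /= => ->.
Qed.

End SuzukiGlue.

Lemma solvabilizer_number_Sz (p : nat) (F : finFieldType)
    (szT : finGroupType) (G : {group szT}) :
  odd p -> (2 < p)%N -> #|F| = (2 ^ p)%N -> G \isog Sz F ->
  simple G -> ~~ abelian G -> ((2 ^ p) ^ 2 + 1 <= solvabilizer_number G)%N.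
Proof.
move=> p_odd p_gt2 cardF isoG simG nabG.
have {}isoG : G \isog suz_group F := isoG.
have Z1 : 'Z(suz_group F) = 1.
  have /simpleP[_ simS] : simple (suz_group F) by rewrite -(isog_simple isoG).
  case: (simS _ (center_normal _)) => // ZS; case/negP: nabG.
  by rewrite (isog_abelian isoG) -ZS center_abelian.
have nsolG : ~~ solvable G.
  apply: contra nabG => solG; apply: cyclic_abelian; apply: prime_cyclic.
  exact: simple_sol_prime.
rewrite /solvabilizer_number.
case: arg_minnP => [|X covX _]; first exact: sol_covering_default.
have [f injf fG] := isogP isoG.
case/andP: covX => sXG /eqP covX.
(* It suffices to bound the image of the covering, which covers the matrix group and avoids 1
   because the radical contains 1. *)
apply: leq_trans (leq_imset_card f X).
have sXG' : X \subset G := subset_trans sXG (subsetDl _ _).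
apply: (sol_covering_card p_odd p_gt2 cardF (@suz_repr_faithful F) Z1
  (card_Sz p_odd cardF) (suz_H_sub p_odd cardF) (card_suz_H p_odd cardF) 
  (suz_H_class p_odd cardF) (suz_cent_involution p_odd cardF)).
- exact: p_odd.
- exact: cardF.
- apply/subsetP=> _ /imsetP[x Xx ->].
  have : f x \in f @* G by rewrite mem_morphim ?(subsetP sXG').
  by rewrite fG.
- apply/imsetP=> -[x Xx /esym/eqP]; rewrite morph_injm_eq1 ?(subsetP sXG') //.
  move/eqP=> x1; move: (subsetP sXG x Xx).
  by rewrite x1 inE (group1 (sol_radical_group G)).
move=> g suzg; have : g \in f @* G by rewrite fG.
case/morphimP=> h Gh _ ->.
have : h \in \bigcup_(x in X) solvabilizer G x by rewrite -covX.
case/bigcupP=> x Xx; rewrite inE => /andP[_ solxh].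
exists (f x); first exact: imset_f.
have Gx := subsetP sXG' x Xx.
have -> : [set f x; f h] = f @* [set x; h].
  by rewrite morphimU !morphim_set1.
rewrite -morphim_gen ?morphim_sol //.
by apply/subsetP=> z /set2P[]->.
Qed.

End SuzukiTori.

Import SuzukiTori.

Theorem theorem4p7 (p : nat) (F : finFieldType) (gT : finGroupType)
    (G : {group gT}) :
  prime p -> odd p -> #|F| = 2 ^ p ->
  (G \isog Sz F)%g -> minimal_simple G ->
  (2 ^ p) ^ 2 + 1 <= solvabilizer_number G.
Proof.
move=> p_pr p_odd cardF isoG [simG nabG _].
apply: solvabilizer_number_Sz isoG simG nabG => //.
by rewrite odd_prime_gt2.
Qed.
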